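(* Let $\Omega\subset\mathbb{R}^n$ be a bounded open set and let $f,g\in C(\Omega)$. Suppose $u\in C(\Omega)$ is simultaneously a viscosity solution of $$\frac{\Delta_\infty u}{|Du|^2}=-g(x)\quad\text{and of}\quad\frac{\Delta_\infty u}{|Du|^2}=-f(x)\quad\text{in }\Omega.$$ Then $f=g$ in $\Omega$.
   Context: $\Delta_\infty u=Du\cdot D^2u\cdot Du$. Viscosity solutions of $\frac{\Delta_\infty u}{|Du|^2}=-h(x)$ in $\Omega$, with $h\in C(\Omega)$: $u\in C(\Omega)$ is a viscosity supersolution if for every $x_0\in\Omega$ and $\phi\in C^2(\Omega)$ with $0=\phi(x_0)-u(x_0)\ge\phi(x)-u(x)$ for all $x\in\Omega$, either (1) $D\phi(x_0)\ne0$ and $\Delta_\infty\phi(x_0)\le -h(x_0)|D\phi(x_0)|^2$, or (2) $D\phi(x_0)=0$ and $\min_{|p|=1}p\cdot D^2\phi(x_0)\cdot p\le -h(x_0)$. It is a viscosity subsolution if for every $x_0\in\Omega$ and $\phi\in C^2(\Omega)$ with $0=\phi(x_0)-u(x_0)\le\phi(x)-u(x)$ for all $x\in\Omega$, either (1) $D\phi(x_0)\ne0$ and $\Delta_\infty\phi(x_0)\ge -h(x_0)|D\phi(x_0)|^2$, or (2) $D\phi(x_0)=0$ and $\max_{|p|=1}p\cdot D^2\phi(x_0)\cdot p\ge -h(x_0)$. A viscosity solution is both. *)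

(* Defs.v *)
From Stdlib Require Import Reals.
From mathcomp Require Import ssreflect ssrfun ssrbool eqtype ssrnat seq fintype bigop.

Set Implicit Arguments.
Unset Strict Implicit.

Local Open Scope R_scope.

Definition vec (n : nat) := 'I_n -> R.

Definition vsub {n} (x y : vec n) : vec n := fun i => x i - y i.

Definition dot {n} (x y : vec n) : R := \big[Rplus/R0]_(i < n) (x i * y i).

Definition vnorm {n} (x : vec n) : R := sqrt (dot x x).

Definition quad {n} (A : 'I_n -> 'I_n -> R) (p : vec n) : R :=
  \big[Rplus/R0]_(i < n) \big[Rplus/R0]_(j < n) (p i * A i j * p j).

Definition is_open {n} (Om : vec n -> Prop) : Prop :=
  forall x, Om x -> exists r, 0 < r /\ forall y, vnorm (vsub y x) < r -> Om y.

Definition is_bounded {n} (Om : vec n -> Prop) : Prop :=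
  exists M, forall x, Om x -> vnorm x <= M.

Definition cont_on {n} (Om : vec n -> Prop) (f : vec n -> R) : Prop :=
  forall x, Om x -> forall eps, 0 < eps -> exists delta, 0 < delta /\
    forall y, Om y -> vnorm (vsub y x) < delta -> Rabs (f y - f x) < eps.

Definition is_C2 {n} (Om : vec n -> Prop) (phi : vec n -> R)
  (Dphi : vec n -> vec n) (D2phi : vec n -> 'I_n -> 'I_n -> R) : Prop :=
  (forall x, Om x -> forall eps, 0 < eps -> exists delta, 0 < delta /\
     forall y, vnorm (vsub y x) < delta ->
       Rabs (phi y - phi x - dot (Dphi x) (vsub y x)) <= eps * vnorm (vsub y x)) /\
  (forall x, Om x -> forall (i : 'I_n) eps, 0 < eps -> exists delta, 0 < delta /\
     forall y, vnorm (vsub y x) < delta ->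
       Rabs (Dphi y i - Dphi x i - dot (D2phi x i) (vsub y x))
         <= eps * vnorm (vsub y x)) /\
  (forall i j, cont_on Om (fun x => D2phi x i j)).

Definition inf_lap {n} (Dphi : vec n -> vec n) (D2phi : vec n -> 'I_n -> 'I_n -> R)
  (x : vec n) : R := quad (D2phi x) (Dphi x).

Definition is_zero_vec {n} (p : vec n) : Prop := forall i, p i = 0.

(* Viscosity supersolution of  Delta_inf u / |Du|^2 = - h  in Om. *)
Definition visc_super {n} (Om : vec n -> Prop) (h u : vec n -> R) : Prop :=
  cont_on Om u /\
  forall x0 phi Dphi D2phi, Om x0 -> is_C2 Om phi Dphi D2phi ->
    phi x0 = u x0 -> (forall x, Om x -> phi x - u x <= 0) ->
    (~ is_zero_vec (Dphi x0) /\
       inf_lap Dphi D2phi x0 <= - h x0 * (vnorm (Dphi x0))^2)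
    \/
    (is_zero_vec (Dphi x0) /\
       (* min_{|p|=1} p.D2phi(x0).p <= -h(x0) *)
       exists p : vec n, vnorm p = 1 /\ quad (D2phi x0) p <= - h x0).

Definition visc_sub {n} (Om : vec n -> Prop) (h u : vec n -> R) : Prop :=
  cont_on Om u /\
  forall x0 phi Dphi D2phi, Om x0 -> is_C2 Om phi Dphi D2phi ->
    phi x0 = u x0 -> (forall x, Om x -> 0 <= phi x - u x) ->
    (~ is_zero_vec (Dphi x0) /\
       inf_lap Dphi D2phi x0 >= - h x0 * (vnorm (Dphi x0))^2)
    \/
    (is_zero_vec (Dphi x0) /\
       (* max_{|p|=1} p.D2phi(x0).p >= -h(x0) *)
       exists p : vec n, vnorm p = 1 /\ quad (D2phi x0) p >= - h x0).

Definition visc_sol {n} (Om : vec n -> Prop) (h u : vec n -> R) : Prop :=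
  visc_super Om h u /\ visc_sub Om h u.

(* Main.v *)
From HB Require Import structures.
Require Import Defs.
From Stdlib Require Import Reals Lra Lia Classical ClassicalEpsilon FunctionalExtensionality.
From mathcomp Require Import ssreflect ssrfun ssrbool eqtype ssrnat seq choice fintype finfun bigop.
From Coquelicot Require Import Coquelicot.
Local Open Scope R_scope.

(** Suppose [f x0 < g x0]. Near [x0], [u] is a subsolution with constant right-hand side
    [-a] and a supersolution with [-b], where [a < b]. Testing with radial functions shows
    that a subsolution is compared from above with the paraboloidal cones
    [S |x - q| - a |x - q|^2 / 2], and symmetrically for the supersolution. Hence if
    [|p - x| = eps] and [u p - u x] is not too small, some [z] with [|z - x| = 2 eps] has
    [u z - 2 u p + u x >= - a eps^2], and likewise downwards with [b].

    Take [x] and [|e| = eps] almost maximizing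
    [u (x + e) - u (x - e) - eps K |x - c|^2], and let [2 eps L] be the increment
    [u (x + e) - u (x - e)]. The upward and downward extensions [zp], [zm] of [x + e], [x - e]
    satisfy [u zp - u zm >= 4 eps L + (b - a) eps^2]. As the slope of [u] near [x] is at most
    [L + O(eps)], they are nearly [4 eps] apart, so [x] is their midpoint up to
    [O(eps^(3/2))]. Comparing with the pairs centred at the midpoints of [x, zp] and [x, zm]
    the first-order terms of the penalization cancel up to [o(eps)], which gives
    [(b - a) eps^2 <= o(eps^2)], provided [L] stays away from [0]. This is ensured by
    choosing [c] on a segment along which [u] increases; if there is none, [u] is
    constant near [x0], and constants as test functions give [f x0 >= 0 >= g x0].

    Test functions must lie above [u] on all of [Om], where [u] may be unbounded: local ones
    are corrected by [|x - x0|^4 G x] with [G] a C2 majorant of a given continuous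
    function. *)

(** * Euclidean space: inner product, norm and distance *)

Lemma Rplus_associative : associative Rplus. Proof. by move=> x y z; ring. Qed.
Lemma Rplus_commutative : commutative Rplus. Proof. by move=> x y; ring. Qed.
Lemma Rplus_left_id : left_id R0 Rplus. Proof. by move=> x; ring. Qed.

HB.instance Definition _ := Monoid.isComLaw.Build R R0 Rplus
  Rplus_associative Rplus_commutative Rplus_left_id.

Section Vectors.
Context {n : nat}.
Implicit Types (x y z e p q : vec n) (t : R).

(** The scalar is built in, so that sums, differences and points of a line through [x] share one set
    of expansion rules. *)
Definition vadd x t e : vec n := fun i => x i + t * e i.

Definition vdist x y : R := vnorm (vsub x y).

Lemma big_Rscal (F : 'I_n -> R) t :
  \big[Rplus/R0]_(i < n) (t * F i) = t * \big[Rplus/R0]_(i < n) F i.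
Proof.
by apply: (big_rec2 (fun a b => a = t * b)) => [|i a b _ ->]; ring.
Qed.

Lemma big_Rle (F G : 'I_n -> R) : (forall i, F i <= G i) ->
  \big[Rplus/R0]_(i < n) F i <= \big[Rplus/R0]_(i < n) G i.
Proof.
move=> FG; apply: (big_ind2 (fun a b => a <= b)) => [|a b c d|i _] //; lra.
Qed.

Lemma dotC x y : dot x y = dot y x.
Proof. by apply: eq_bigr => i _; ring. Qed.

Lemma dot_vaddl x t e y : dot (vadd x t e) y = dot x y + t * dot e y.
Proof. by rewrite /dot -big_Rscal -big_split; apply: eq_bigr => i _ /=; rewrite /vadd; ring. Qed.

Lemma dot_vaddr x t e y : dot y (vadd x t e) = dot y x + t * dot y e.
Proof. by rewrite dotC dot_vaddl !(dotC y). Qed.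

Lemma vsubE x y : vsub x y = vadd x (-1) y.
Proof. by apply: functional_extensionality => i; rewrite /vsub /vadd; ring. Qed.

Lemma dot_vsubl x y z : dot (vsub x y) z = dot x z - dot y z.
Proof. by rewrite vsubE dot_vaddl; ring. Qed.

Lemma dot_vsubr x y z : dot z (vsub x y) = dot z x - dot z y.
Proof. by rewrite vsubE dot_vaddr; ring. Qed.

Lemma dot_scall t x y : dot (fun i => t * x i) y = t * dot x y.
Proof. by rewrite /dot -big_Rscal; apply: eq_bigr => i _; ring. Qed.

Lemma dot_scalr t x y : dot y (fun i => t * x i) = t * dot y x.
Proof. by rewrite dotC dot_scall dotC. Qed.

Lemma dot_ge0 x : 0 <= dot x x.
Proof.
rewrite /dot; apply: (big_ind (fun a => 0 <= a)) => [|a b|i _]; try lra.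
exact: Rle_0_sqr.
Qed.

Lemma vnorm_ge0 x : 0 <= vnorm x.
Proof. exact: sqrt_pos. Qed.

Lemma vnorm_sqr x : vnorm x * vnorm x = dot x x.
Proof. exact: sqrt_sqrt (dot_ge0 x). Qed.

Lemma coord_le_vnorm x i : Rabs (x i) <= vnorm x.
Proof.
have ge0 := vnorm_ge0 x.
apply: Rsqr_incr_0_var => //; rewrite -Rsqr_abs /Rsqr vnorm_sqr /dot (bigD1 i) //=.
rewrite -{1}[x i * x i]Rplus_0_r; apply: Rplus_le_compat_l.
by apply: (big_ind (fun a => 0 <= a)) => [|a b|j _]; try lra; exact: Rle_0_sqr.
Qed.

Lemma vnorm_eq0 x : vnorm x = 0 -> is_zero_vec x.
Proof.
move=> x0 i; have := coord_le_vnorm x i; rewrite x0 => H.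
by case: (Req_dec (x i) 0) => // /Rabs_pos_lt; lra.
Qed.

(** The polynomial [|x + t y|^2] in [t] is nonnegative, and its value at the minimizer
    [t = - (x.y) / (y.y)] gives the inequality; [y = 0] is treated apart. *)
Lemma cauchy_schwarz x y : Rabs (dot x y) <= vnorm x * vnorm y.
Proof.
have hx := vnorm_ge0 x; have hy := vnorm_ge0 y.
have hxx := vnorm_sqr x; have hyy := vnorm_sqr y.
have Q t : 0 <= dot x x + 2 * t * dot x y + t * t * dot y y.
  have := dot_ge0 (vadd x t y); rewrite dot_vaddl !dot_vaddr (dotC y x) => H.
  by apply: Rle_trans H _; apply: Req_le; ring.
apply: Rsqr_incr_0_var; last by apply: Rmult_le_pos.
rewrite -Rsqr_abs /Rsqr.
have -> : vnorm x * vnorm y * (vnorm x * vnorm y) = dot x x * dot y y.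
  by rewrite -hxx -hyy; ring.
have [y0|y0] : dot y y = 0 \/ 0 < dot y y by have := dot_ge0 y; lra.
  have z : is_zero_vec y by apply: vnorm_eq0; nra.
  suff -> : dot x y = 0 by rewrite y0; lra.
  by rewrite /dot big1 // => i _; rewrite z; ring.
have H := Q (- dot x y / dot y y).
apply: (Rmult_le_reg_l (/ dot y y)); first exact: Rinv_0_lt_compat.
have -> : / dot y y * (dot x x * dot y y) = dot x x by field; lra.
have E : dot x x + 2 * (- dot x y / dot y y) * dot x y +
  (- dot x y / dot y y) * (- dot x y / dot y y) * dot y y =
  dot x x - / dot y y * (dot x y * dot x y) by field; lra.
lra.
Qed.

Lemma vnorm_triangle x y t : vnorm (vadd x t y) <= vnorm x + Rabs t * vnorm y.
Proof.
have hx := vnorm_ge0 x; have hy := vnorm_ge0 y; have ht := Rabs_pos t.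
have hty : 0 <= Rabs t * vnorm y by apply: Rmult_le_pos.
apply: Rsqr_incr_0_var; last lra.
rewrite /Rsqr vnorm_sqr dot_vaddl !dot_vaddr (dotC y x) -!vnorm_sqr.
have cs := cauchy_schwarz x y.
have : t * dot x y <= Rabs t * (vnorm x * vnorm y).
  apply: Rle_trans (Rle_abs _) _; rewrite Rabs_mult.
  exact: Rmult_le_compat_l.
have : t * t = Rabs t * Rabs t by rewrite -Rabs_mult Rabs_pos_eq //; nra.
move=> tt H.
have -> : vnorm x * vnorm x + t * dot x y + t * (dot x y + t * (vnorm y * vnorm y)) =
  vnorm x * vnorm x + 2 * (t * dot x y) + (t * t) * (vnorm y * vnorm y) by ring.
rewrite tt; lra.
Qed.

Lemma vnorm_scal t x : vnorm (fun i => t * x i) = Rabs t * vnorm x.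
Proof.
rewrite /vnorm dot_scall dot_scalr -Rmult_assoc sqrt_mult; [|nra|exact: dot_ge0].
by rewrite -/(Rsqr t) sqrt_Rsqr_abs.
Qed.

Lemma vdist_ge0 x y : 0 <= vdist x y.
Proof. exact: vnorm_ge0. Qed.

Lemma vdist_sym x y : vdist x y = vdist y x.
Proof.
rewrite /vdist -[vnorm (vsub y x)]Rmult_1_l -{1}Rabs_R1 -Rabs_Ropp -vnorm_scal.
by congr vnorm; apply: functional_extensionality => i; rewrite /vsub; ring.
Qed.

Lemma vdist_triangle y x z : vdist x z <= vdist x y + vdist y z.
Proof.
have := vnorm_triangle (vsub x y) (vsub y z) 1; rewrite Rabs_R1 Rmult_1_l => H.
apply: Rle_trans H; apply: Req_le; congr vnorm.
by apply: functional_extensionality => i; rewrite /vsub /vadd; ring.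
Qed.

Lemma vdist_refl x : vdist x x = 0.
Proof.
rewrite /vdist /vnorm dot_vsubl Rminus_diag; exact: sqrt_0.
Qed.

Lemma vdist_eq0 x y : vdist x y = 0 -> x = y.
Proof.
move=> /vnorm_eq0 H; apply: functional_extensionality => i.
by have := H i; rewrite /vsub; lra.
Qed.

Lemma vdist_vadd x t e : vdist (vadd x t e) x = Rabs t * vnorm e.
Proof.
rewrite /vdist -vnorm_scal; congr vnorm.
by apply: functional_extensionality => i; rewrite /vsub /vadd; ring.
Qed.

Lemma vdist_sqr x y : vdist x y * vdist x y = dot (vsub x y) (vsub x y).
Proof. exact: vnorm_sqr. Qed.

Lemma dot_one (j : 'I_n) (x : vec n) t : dot (fun i => if i == j then t else 0) x = t * x j.
Proof.
rewrite /dot (bigD1 j) //= eqxx big1 => [|i /negbTE ->]; first by rewrite /=; ring.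
by ring.
Qed.

Lemma vnorm_le_sum x t : (forall i, Rabs (x i) <= t) -> 0 <= t -> vnorm x <= INR n * t.
Proof.
move=> xt t0.
have nt : 0 <= INR n * t by apply: Rmult_le_pos => //; exact: pos_INR.
apply: Rsqr_incr_0_var => //; rewrite /Rsqr vnorm_sqr.
have -> : INR n * t * (INR n * t) = INR n * (INR n * (t * t)) by ring.
apply: (Rle_trans _ (INR n * (t * t))).
  have -> : INR n * (t * t) = \big[Rplus/R0]_(i < n) (t * t).
    rewrite big_const card_ord; elim: {+}n => [|m IH]; first by rewrite /=; ring.
    by rewrite S_INR /= -IH; ring.
  apply: big_Rle => i; rewrite -(Rabs_pos_eq (x i * x i)); last exact: Rle_0_sqr.
  by rewrite Rabs_mult; apply: Rmult_le_compat => //; exact: Rabs_pos.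
have tt : 0 <= t * t by nra.
case: {+}n => [|m]; first by rewrite /=; lra.
by rewrite S_INR; have := pos_INR m; nra.
Qed.

End Vectors.

(** * Differentiability at a point and closure properties of C2 functions *)

Section Calculus.
Context {n : nat}.
Implicit Types (x y z e p q : vec n) (phi psi : vec n -> R) (Om : vec n -> Prop).

(** This has the form of the clauses of [is_C2], so that one set of rules serves a function and each
    component of its gradient. *)
Definition diff_at phi x p : Prop :=
  forall eps, 0 < eps -> exists delta, 0 < delta /\
    forall y, vnorm (vsub y x) < delta ->
      Rabs (phi y - phi x - dot p (vsub y x)) <= eps * vnorm (vsub y x).

Definition cont_at phi x : Prop :=
  forall eps, 0 < eps -> exists delta, 0 < delta /\
    forall y, vnorm (vsub y x) < delta -> Rabs (phi y - phi x) < eps.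

Lemma diff_at_lip phi x p : diff_at phi x p ->
  exists delta, 0 < delta /\ forall y, vnorm (vsub y x) < delta ->
    Rabs (phi y - phi x) <= (vnorm p + 1) * vnorm (vsub y x).
Proof.
move=> /(_ 1 Rlt_0_1) [d [d0 H]]; exists d; split=> // y /H.
have cs := cauchy_schwarz p (vsub y x).
have := Rabs_triang (phi y - phi x - dot p (vsub y x)) (dot p (vsub y x)).
have -> : phi y - phi x - dot p (vsub y x) + dot p (vsub y x) = phi y - phi x by ring.
lra.
Qed.

Lemma diff_at_cont phi x p : diff_at phi x p -> cont_at phi x.
Proof.
move=> /diff_at_lip [d [d0 H]] eps eps0.
have p0 := vnorm_ge0 p.
have c0 : 0 < eps / (vnorm p + 1) by apply: Rdiv_lt_0_compat; lra.
exists (Rmin d (eps / (vnorm p + 1))); split; first exact: Rmin_pos.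
move=> y hy; have yd : vnorm (vsub y x) < d by apply: Rlt_le_trans hy (Rmin_l _ _).
have yc := Rlt_le_trans _ _ _ hy (Rmin_r _ _).
apply: Rle_lt_trans (H _ yd) _.
have -> : eps = (vnorm p + 1) * (eps / (vnorm p + 1)) by field; lra.
by apply: Rmult_lt_compat_l => //; lra.
Qed.

Lemma diff_at_const c x : diff_at (fun _ => c) x (fun _ => 0).
Proof.
move=> eps eps0; exists 1; split=> [|y _]; first lra.
have -> : dot (fun _ => 0) (vsub y x) = 0 by rewrite /dot big1 // => i _; ring.
have -> : c - c - 0 = 0 by ring.
by rewrite Rabs_R0; have := vnorm_ge0 (vsub y x); nra.
Qed.

Lemma diff_at_plus phi psi x p q : diff_at phi x p -> diff_at psi x q ->
  diff_at (fun y => phi y + psi y) x (fun i => p i + q i).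
Proof.
move=> hp hq eps eps0.
have [d [d0 H]] := hp (eps / 2) ltac:(lra).
have [d' [d'0 H']] := hq (eps / 2) ltac:(lra).
exists (Rmin d d'); split=> [|y hy]; first exact: Rmin_pos.
have h1 := H _ (Rlt_le_trans _ _ _ hy (Rmin_l _ _)).
have h2 := H' _ (Rlt_le_trans _ _ _ hy (Rmin_r _ _)).
have -> : dot (fun i => p i + q i) (vsub y x) = dot p (vsub y x) + dot q (vsub y x).
  by rewrite /dot -big_split; apply: eq_bigr => i _ /=; ring.
apply: Rle_trans (_ : _ <= eps / 2 * vnorm (vsub y x) + eps / 2 * vnorm (vsub y x)) _; last lra.
apply: Rle_trans (Rplus_le_compat _ _ _ _ h1 h2).
apply: Rle_trans (Rabs_triang _ _).
by apply: Req_le; congr Rabs; ring.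
Qed.

Lemma diff_at_comp (F : R -> R) phi x p l : derivable_pt_lim F (phi x) l ->
  diff_at phi x p -> diff_at (fun y => F (phi y)) x (fun i => l * p i).
Proof.
move=> hF hp eps eps0.
have p0 := vnorm_ge0 p; have l0 := Rabs_pos l.
have e1 : 0 < eps / 2 / (vnorm p + 1) by apply: Rdiv_lt_0_compat; lra.
have e2 : 0 < eps / 2 / (Rabs l + 1) by apply: Rdiv_lt_0_compat; lra.
have [d HF] := hF _ e1.
have [d1 [d10 H1]] := diff_at_lip _ _ _ hp.
have [d2 [d20 H2]] := diff_at_cont _ _ _ hp d (cond_pos d).
have [d3 [d30 H3]] := hp _ e2.
exists (Rmin d1 (Rmin d2 d3)); split=> [|y hy]; first by do 2?apply: Rmin_pos.
have hy1 := Rlt_le_trans _ _ _ hy (Rmin_l _ _).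
have hy' := Rlt_le_trans _ _ _ hy (Rmin_r _ _).
have hy2 := Rlt_le_trans _ _ _ hy' (Rmin_l _ _).
have hy3 := Rlt_le_trans _ _ _ hy' (Rmin_r _ _).
move: (H1 _ hy1) (H2 _ hy2) (H3 _ hy3); rewrite dot_scall.
set N := vnorm (vsub y x); set dl := phi y - phi x => h1 h2 h3.
have N0 : 0 <= N by apply: vnorm_ge0.
have A : Rabs (F (phi y) - F (phi x) - l * dl) <= eps / 2 / (vnorm p + 1) * Rabs dl.
  (* [derivable_pt_lim] speaks only of nonzero increments. *)
  case: (Req_dec dl 0) => [z|nz].
    have -> : phi y = phi x by rewrite /dl in z; lra.
    by rewrite z Rminus_diag Rmult_0_r Rminus_diag Rabs_R0 Rmult_0_r; lra.
  have := HF _ nz h2; have -> : phi x + dl = phi y by rewrite /dl; ring.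
  have -> : F (phi y) - F (phi x) - l * dl = ((F (phi y) - F (phi x)) / dl - l) * dl by field.
  by rewrite Rabs_mult => hh; apply: Rmult_le_compat_r; [exact: Rabs_pos|lra].
have B : Rabs (l * (dl - dot p (vsub y x))) <= Rabs l * (eps / 2 / (Rabs l + 1) * N).
  by rewrite Rabs_mult; apply: Rmult_le_compat_l.
have A' : eps / 2 / (vnorm p + 1) * Rabs dl <= eps / 2 * N.
  have -> : eps / 2 * N = eps / 2 / (vnorm p + 1) * ((vnorm p + 1) * N) by field; lra.
  by apply: Rmult_le_compat_l => //; lra.
have B' : Rabs l * (eps / 2 / (Rabs l + 1) * N) <= eps / 2 * N.
  have E : eps / 2 * N = (Rabs l + 1) * (eps / 2 / (Rabs l + 1) * N) by field; lra.
  rewrite E; apply: Rmult_le_compat_r; last lra.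
  by apply: Rmult_le_pos => //; lra.
have := Rabs_triang (F (phi y) - F (phi x) - l * dl) (l * (dl - dot p (vsub y x))).
have -> : F (phi y) - F (phi x) - l * dl + l * (dl - dot p (vsub y x)) =
  F (phi y) - F (phi x) - l * dot p (vsub y x) by ring.
lra.
Qed.

(* Polarization: [phi * psi = (phi + psi)^2/4 - (phi - psi)^2/4]. *)
Lemma diff_at_mult phi psi x p q : diff_at phi x p -> diff_at psi x q ->
  diff_at (fun y => phi y * psi y) x (fun i => phi x * q i + psi x * p i).
Proof.
move=> hp hq.
have sq c t : derivable_pt_lim (fun s => c * (s * s)) t (c * (2 * t)).
  apply/is_derive_Reals; auto_derive => //; ring.
have opp t : derivable_pt_lim (fun s => - s) t (-1).
  apply/is_derive_Reals; auto_derive => //; ring.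
have hm := diff_at_plus _ _ _ _ _ hp (diff_at_comp _ _ _ _ _ (opp _) hq).
have ha := diff_at_plus _ _ _ _ _ hp hq.
have h1 := diff_at_comp _ _ _ _ _ (sq (1/4) _) ha.
have h2 := diff_at_comp _ _ _ _ _ (sq (-1/4) _) hm.
have h := diff_at_plus _ _ _ _ _ h1 h2.
have -> : (fun y => phi y * psi y) = (fun y => 1 / 4 * ((phi y + psi y) * (phi y + psi y)) +
   -1 / 4 * ((phi y + - psi y) * (phi y + - psi y))).
  by apply: functional_extensionality => y; field.
suff -> : (fun i => phi x * q i + psi x * p i) = (fun i : 'I_n =>
         1 / 4 * (2 * (phi x + psi x)) * (p i + q i) +
         -1 / 4 * (2 * (phi x + - psi x)) * (p i + -1 * q i)) by [].
by apply: functional_extensionality => i; field.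
Qed.

Lemma cont_at_on Om phi : (forall x, Om x -> cont_at phi x) -> cont_on Om phi.
Proof.
move=> H x Ox eps eps0; have [d [d0 h]] := H x Ox _ eps0.
by exists d; split=> // y _; exact: h.
Qed.

Lemma cont_on_const Om c : cont_on Om (fun _ => c).
Proof.
move=> x _ eps eps0; exists 1; split=> [|y _ _]; first lra.
by rewrite Rminus_diag Rabs_R0.
Qed.

Lemma cont_on_comp2 Om (F : R -> R -> R) phi psi :
  (forall a b eps, 0 < eps -> exists delta, 0 < delta /\ forall a' b',
     Rabs (a' - a) < delta -> Rabs (b' - b) < delta -> Rabs (F a' b' - F a b) < eps) ->
  cont_on Om phi -> cont_on Om psi -> cont_on Om (fun y => F (phi y) (psi y)).
Proof.
move=> HF hp hq x Ox eps eps0.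
have [d [d0 H]] := HF (phi x) (psi x) _ eps0.
have [d1 [d10 H1]] := hp _ Ox _ d0; have [d2 [d20 H2]] := hq _ Ox _ d0.
exists (Rmin d1 d2); split=> [|y Oy hy]; first exact: Rmin_pos.
by apply: H; [apply: H1 | apply: H2] => //; apply: Rlt_le_trans hy _;
  [exact: Rmin_l | exact: Rmin_r].
Qed.

Lemma cont_on_plus Om phi psi : cont_on Om phi -> cont_on Om psi ->
  cont_on Om (fun y => phi y + psi y).
Proof.
apply: cont_on_comp2 => a b eps eps0; exists (eps / 2); split=> [|a' b' h1 h2]; first lra.
have -> : a' + b' - (a + b) = (a' - a) + (b' - b) by ring.
by apply: Rle_lt_trans (Rabs_triang _ _) _; lra.
Qed.

Lemma cont_on_mult Om phi psi : cont_on Om phi -> cont_on Om psi ->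
  cont_on Om (fun y => phi y * psi y).
Proof.
apply: cont_on_comp2 => a b eps eps0.
have a0 := Rabs_pos a; have b0 := Rabs_pos b.
have c0 : 0 < eps / (Rabs a + Rabs b + 1) by apply: Rdiv_lt_0_compat; lra.
exists (Rmin 1 (eps / (Rabs a + Rabs b + 1))); split=> [|a' b' h1 h2].
  by apply: Rmin_pos => //; lra.
have m1 := Rlt_le_trans _ _ _ h1 (Rmin_l _ _); have m2 := Rlt_le_trans _ _ _ h1 (Rmin_r _ _).
have m3 := Rlt_le_trans _ _ _ h2 (Rmin_r _ _).
have -> : a' * b' - a * b = (a' - a) * (b' - b) + (a * (b' - b) + b * (a' - a)) by ring.
apply: Rle_lt_trans (Rabs_triang _ _) _; rewrite Rabs_mult.
have := Rabs_triang (a * (b' - b)) (b * (a' - a)); rewrite !Rabs_mult.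
move: m1 m2 m3; have := Rabs_pos (a' - a); have := Rabs_pos (b' - b).
set A := Rabs (a' - a); set B := Rabs (b' - b); set c := eps / _ => B0 A0 m1 m2 m3 tri.
have E : eps = (Rabs a + Rabs b + 1) * c by rewrite /c; field; lra.
rewrite E.
have k1 : A * B <= 1 * B by apply: Rmult_le_compat_r; lra.
have k2 : Rabs a * B <= Rabs a * c by apply: Rmult_le_compat_l; lra.
have k3 : Rabs b * A <= Rabs b * c by apply: Rmult_le_compat_l; lra.
lra.
Qed.

Lemma cont_on_comp Om (F : R -> R) phi : (forall x, Om x -> continuity_pt F (phi x)) ->
  cont_on Om phi -> cont_on Om (fun y => F (phi y)).
Proof.
move=> HF hp x Ox eps eps0; have [d [d0 H]] := HF x Ox _ eps0.
have [d1 [d10 H1]] := hp _ Ox _ d0; exists d1; split=> // y Oy hy.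
case: (Req_dec (phi x) (phi y)) => [->|ne]; first by rewrite Rminus_diag Rabs_R0.
by apply: H; split; [split | exact: H1].
Qed.

Lemma is_C2E Om phi Dphi D2phi :
  (forall x, Om x -> diff_at phi x (Dphi x)) ->
  (forall x, Om x -> forall i, diff_at (fun y => Dphi y i) x (D2phi x i)) ->
  (forall i j, cont_on Om (fun x => D2phi x i j)) ->
  is_C2 Om phi Dphi D2phi.
Proof. by move=> h1 h2 h3; split; [exact: h1|split]. Qed.

Lemma is_C2_cont Om phi Dphi D2phi : is_C2 Om phi Dphi D2phi ->
  cont_on Om phi /\ forall i, cont_on Om (fun x => Dphi x i).
Proof.
case=> h1 [h2 _]; split=> [|i]; apply: cont_at_on => x Ox; apply: diff_at_cont.
  exact: h1 x Ox.
exact: h2 x Ox i.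
Qed.

Lemma is_C2_plus Om phi Dphi D2phi psi Dpsi D2psi :
  is_C2 Om phi Dphi D2phi -> is_C2 Om psi Dpsi D2psi ->
  is_C2 Om (fun x => phi x + psi x) (fun x i => Dphi x i + Dpsi x i)
    (fun x i j => D2phi x i j + D2psi x i j).
Proof.
move=> [h1 [h2 h3]] [k1 [k2 k3]]; apply: is_C2E => [x Ox|x Ox i|i j].
- exact: diff_at_plus (h1 x Ox) (k1 x Ox).
- exact: diff_at_plus (h2 x Ox i) (k2 x Ox i).
- exact: cont_on_plus.
Qed.

Lemma is_C2_mult Om phi Dphi D2phi psi Dpsi D2psi :
  is_C2 Om phi Dphi D2phi -> is_C2 Om psi Dpsi D2psi ->
  is_C2 Om (fun x => phi x * psi x) (fun x i => phi x * Dpsi x i + psi x * Dphi x i)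
    (fun x i j => (phi x * D2psi x i j + Dpsi x i * Dphi x j) +
                  (psi x * D2phi x i j + Dphi x i * Dpsi x j)).
Proof.
move=> Hp Hq; have [cp cDp] := is_C2_cont _ _ _ _ Hp; have [cq cDq] := is_C2_cont _ _ _ _ Hq.
case: Hp Hq => h1 [h2 h3] [k1 [k2 k3]]; apply: is_C2E => [x Ox|x Ox i|i j].
- exact: diff_at_mult (h1 x Ox) (k1 x Ox).
- apply: diff_at_plus; [exact: diff_at_mult (h1 x Ox) (k2 x Ox i)|].
  exact: diff_at_mult (k1 x Ox) (h2 x Ox i).
- by do 2?apply: cont_on_plus; apply: cont_on_mult => //.
Qed.

Lemma is_C2_comp Om (F F' F'' : R -> R) phi Dphi D2phi :
  is_C2 Om phi Dphi D2phi ->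
  (forall x, Om x -> derivable_pt_lim F (phi x) (F' (phi x))) ->
  (forall x, Om x -> derivable_pt_lim F' (phi x) (F'' (phi x))) ->
  (forall x, Om x -> continuity_pt F'' (phi x)) ->
  is_C2 Om (fun x => F (phi x)) (fun x i => F' (phi x) * Dphi x i)
    (fun x i j => F' (phi x) * D2phi x i j + Dphi x i * (F'' (phi x) * Dphi x j)).
Proof.
move=> Hp HF HF' cF; have [cp cDp] := is_C2_cont _ _ _ _ Hp.
case: Hp => h1 [h2 h3]; apply: is_C2E => [x Ox|x Ox i|i j].
- exact: diff_at_comp (HF x Ox) (h1 x Ox).
- exact: diff_at_mult (diff_at_comp _ _ _ _ _ (HF' x Ox) (h1 x Ox)) (h2 x Ox i).
- have cF' : cont_on Om (fun x => F' (phi x)).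
    apply: cont_on_comp => // x Ox.
    by apply: derivable_continuous_pt; exists (F'' (phi x)); apply: HF'.
  have cF'' : cont_on Om (fun x => F'' (phi x)) by exact: cont_on_comp.
  by apply: cont_on_plus; apply: cont_on_mult => //; apply: cont_on_mult.
Qed.

Lemma is_C2_const Om c : is_C2 Om (fun _ => c) (fun _ _ => 0) (fun _ _ _ => 0).
Proof.
apply: is_C2E => [x _|x _ i|i j]; try exact: diff_at_const; exact: cont_on_const.
Qed.

(** Unlike [vdist], the squared distance is C2 everywhere; bumps and radial test functions are
    written in terms of it. *)
Definition sqdist q x : R := dot (vsub x q) (vsub x q).

Lemma sqdistE q x y :
  sqdist q y = sqdist q x + 2 * dot (vsub x q) (vsub y x) + dot (vsub y x) (vsub y x).
Proof.
rewrite /sqdist !dot_vsubl !dot_vsubr (dotC y x) (dotC q x) (dotC q y); ring.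
Qed.

Lemma is_C2_sqdist Om q :
  is_C2 Om (sqdist q) (fun x i => 2 * vsub x q i) (fun _ i j => if j == i then 2 else 0).
Proof.
apply: is_C2E => [x _|x _ i|i j]; last exact: cont_on_const.
- move=> eps eps0; exists eps; split=> // y hy.
  rewrite (sqdistE q x y) dot_scall -vnorm_sqr.
  have N0 := vnorm_ge0 (vsub y x).
  have -> : forall a b c, a + 2 * b + c - a - 2 * b = c by move=> *; ring.
  by rewrite Rabs_pos_eq; nra.
- move=> eps eps0; exists 1; split=> [|y _]; first lra.
  rewrite dot_one /vsub.
  have -> : 2 * (y i - q i) - 2 * (x i - q i) - 2 * (y i - x i) = 0 by ring.
  by rewrite Rabs_R0; have := vnorm_ge0 (fun i0 => y i0 - x i0); nra.
Qed.

End Calculus.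

(** * Uniform C2 bounds, series of C2 functions and the cubed positive part *)

Section UniformC2.
Context {n : nat}.
Implicit Types (x y z e p q : vec n) (phi psi : vec n -> R) (Om : vec n -> Prop).

(* A quantitative form of [is_C2] that passes to series of functions. *)
Definition unif_C2 Om C phi (Dphi : vec n -> vec n) (D2phi : vec n -> 'I_n -> 'I_n -> R) :=
  forall x y, Om x -> vdist y x <= 1 ->
  [/\ Rabs (phi y) <= C * 1 /\ (forall i, Rabs (Dphi y i) <= C * 1),
      forall i j, Rabs (D2phi y i j) <= C * 1,
      Rabs (phi y - phi x - dot (Dphi x) (vsub y x)) <= C * (vdist y x * vdist y x),
      forall i, Rabs (Dphi y i - Dphi x i - dot (D2phi x i) (vsub y x)) <=
        C * (vdist y x * vdist y x)
    & forall i j, Rabs (D2phi y i j - D2phi x i j) <= C * vdist y x].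

Lemma unif_C2_is_C2 Om C phi Dphi D2phi :
  unif_C2 Om C phi Dphi D2phi -> is_C2 Om phi Dphi D2phi.
Proof.
move=> H.
(* A quadratic remainder [C t^2] is below [eps t] once [t < eps / (|C| + 1)]; the sign of [C] is
   left open. *)
have key eps : 0 < eps -> exists d, 0 < d /\ d <= 1 /\ forall t, 0 <= t -> t < d ->
    C * (t * t) <= eps * t /\ C * t < eps.
  move=> eps0; have C0 := Rabs_pos C; have C1 := Rle_abs C.
  have c0 : 0 < eps / (Rabs C + 1) by apply: Rdiv_lt_0_compat; lra.
  exists (Rmin 1 (eps / (Rabs C + 1))); split; first by apply: Rmin_pos; lra.
  split=> [|t t0 tl]; first exact: Rmin_l.
  have tl' := Rlt_le_trans _ _ _ tl (Rmin_r _ _).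
  have : (Rabs C + 1) * t < eps.
    have -> : eps = (Rabs C + 1) * (eps / (Rabs C + 1)) by field; lra.
    by apply: Rmult_lt_compat_l => //; lra.
  by move=> h; split; nra.
apply: is_C2E => [x Ox eps /key|x Ox i eps /key|i j x Ox eps /key] [d [d0 [d1 h]]];
  exists d; split=> // y; [| |move=> _]; move=> hy;
  have yx : vdist y x <= 1 by (rewrite /vdist; lra).
- by case: (H x y Ox yx) => _ _ h1 _ _; apply: Rle_trans h1 (proj1 (h _ (vdist_ge0 y x) hy)).
- by case: (H x y Ox yx) => _ _ _ h1 _; apply: Rle_trans (h1 i) (proj1 (h _ (vdist_ge0 y x) hy)).
- by case: (H x y Ox yx) => _ _ _ _ h1; apply: Rle_lt_trans (h1 i j) (proj2 (h _ (vdist_ge0 y x) hy)).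
Qed.

(** The factor [t] lets one domination argument cover all clauses of [unif_C2], whose bounds are [C]
    times 1, a distance or its square. *)
Lemma Series_Rabs_le (a C : nat -> R) t : ex_series C -> (forall k, Rabs (a k) <= C k * t) ->
  ex_series a /\ Rabs (Series a) <= Series C * t.
Proof.
move=> eC le.
have eCt : ex_series (fun k => C k * t) by apply: ex_series_scal_r.
have ea : ex_series (fun k => Rabs (a k)).
  apply: ex_series_le eCt => k; rewrite /norm /= /abs /= Rabs_Rabsolu; exact: le.
split; first exact: ex_series_Rabs.
apply: Rle_trans (Series_Rabs _ ea) _; rewrite -Series_scal_r.
by apply: Series_le => // k; split; [exact: Rabs_pos | exact: le].
Qed.

Lemma is_series_dot (a : nat -> vec n) (v : vec n) : (forall i, ex_series (fun k => a k i)) ->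
  is_series (fun k => dot (a k) v) (dot (fun i => Series (fun k => a k i)) v).
Proof.
move=> ea; rewrite /dot; elim: (index_enum _) => [|i r IH].
  rewrite big_nil; apply: (is_series_ext (fun _ => 0)) => [k|]; first by rewrite big_nil.
  apply/is_series_Reals => eps eps0; exists 0%N => k _.
  by rewrite sum_eq_R0 // /Rdist Rminus_diag Rabs_R0.
rewrite big_cons; apply: (is_series_ext (fun k => a k i * v i + \big[Rplus/R0]_(j <- r) (a k j * v j))).
  by move=> k; rewrite big_cons.
apply: is_series_plus IH; apply: is_series_scal_r; exact: Series_correct.
Qed.

(** Every clause bounds an expression linear in the triple of function, gradient and Hessian, so the
    bounds add up term by term; this takes the place of a theorem on termwise differentiation. *)
Lemma unif_C2_series Om (C : nat -> R) (phi_ : nat -> vec n -> R)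
  (Dphi_ : nat -> vec n -> vec n) (D2phi_ : nat -> vec n -> 'I_n -> 'I_n -> R) : ex_series C ->
  (forall k, unif_C2 Om (C k) (phi_ k) (Dphi_ k) (D2phi_ k)) ->
  unif_C2 Om (Series C) (fun x => Series (fun k => phi_ k x))
    (fun x i => Series (fun k => Dphi_ k x i)) (fun x i j => Series (fun k => D2phi_ k x i j)).
Proof.
move=> eC H x y Ox yx.
have xx : vdist x x <= 1 by rewrite vdist_refl; lra.
have [e0 e1 e2] : [/\ forall z, vdist z x <= 1 -> ex_series (fun k => phi_ k z),
   forall z i, vdist z x <= 1 -> ex_series (fun k => Dphi_ k z i)
  & forall z i j, vdist z x <= 1 -> ex_series (fun k => D2phi_ k z i j)].
  split=> [z zx|z i zx|z i j zx]; apply: (proj1 (Series_Rabs_le _ _ 1 eC _)) => k;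
    by case: (H k x z Ox zx) => -[h1 h2] h3 _ _ _.
split; first split.
- by apply: (proj2 (Series_Rabs_le _ _ _ eC _)) => k; case: (H k x y Ox yx) => -[].
- by move=> i; apply: (proj2 (Series_Rabs_le _ _ _ eC _)) => k; case: (H k x y Ox yx) => -[].
- by move=> i j; apply: (proj2 (Series_Rabs_le _ _ _ eC _)) => k; case: (H k x y Ox yx) => -[].
- have d := is_series_dot (fun k => Dphi_ k x) (vsub y x) (fun i => e1 x i xx).
  have ed := ex_intro _ _ d.
  rewrite -(is_series_unique _ _ d) -!Series_minus; try (by auto); try exact: ex_series_minus (e0 y yx) (e0 x xx).
  by apply: (proj2 (Series_Rabs_le _ _ _ eC _)) => k; case: (H k x y Ox yx).
- move=> i; have d := is_series_dot (fun k => D2phi_ k x i) (vsub y x) (fun j => e2 x i j xx).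
  have ed := ex_intro _ _ d.
  rewrite -(is_series_unique _ _ d) -!Series_minus; try (by auto); try exact: ex_series_minus (e1 y i yx) (e1 x i xx).
  by apply: (proj2 (Series_Rabs_le _ _ _ eC _)) => k; case: (H k x y Ox yx).
- move=> i j; rewrite -Series_minus; auto.
  by apply: (proj2 (Series_Rabs_le _ _ _ eC _)) => k; case: (H k x y Ox yx).
Qed.

Lemma unif_C2_scal Om C c phi Dphi D2phi : 0 <= c ->
  unif_C2 Om C phi Dphi D2phi ->
  unif_C2 Om (c * C) (fun x => c * phi x) (fun x i => c * Dphi x i) (fun x i j => c * D2phi x i j).
Proof.
move=> c0 H x y Ox yx; case: (H x y Ox yx) => -[h1 h2] h3 h4 h5 h6.
have sc a b t : Rabs a <= C * t -> b = c * a -> Rabs b <= c * C * t.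
  move=> h ->; rewrite Rabs_mult (Rabs_pos_eq c) // Rmult_assoc.
  exact: Rmult_le_compat_l.
split; [split=> [|i]|move=> i j| |move=> i|move=> i j]; rewrite ?dot_scall.
- by apply: sc h1 _.
- by apply: sc (h2 i) _.
- by apply: sc (h3 i j) _.
- by apply: sc h4 _; ring.
- by apply: sc (h5 i) _; ring.
- by apply: sc (h6 i j) _; ring.
Qed.

Definition pospart (t : R) : R := Rmax 0 t.

Lemma pospart_cases t : (0 <= t /\ pospart t = t) \/ (t <= 0 /\ pospart t = 0).
Proof.
rewrite /pospart; case: (Rle_dec 0 t) => h; [left|right].
  by split=> //; rewrite Rmax_right.
by split; [lra | rewrite Rmax_left //; lra].
Qed.

Lemma Rabs_le_of a b : - b <= a -> a <= b -> Rabs a <= b.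
Proof. by move=> *; apply: Rabs_le. Qed.

(** For [F(s) = (s_+)^3] one has [F' = 3 (s_+)^2] and [F'' = 6 s_+]; on [s <= 1] both [F''] and its
    Lipschitz constant are at most 6. The first two bounds are Taylor estimates with [3 = 6 / 2]. *)
Lemma pospart_cube_taylor s s' : s <= 1 -> s' <= 1 ->
  [/\ Rabs (pospart s' ^ 3 - pospart s ^ 3 - 3 * pospart s ^ 2 * (s' - s)) <=
        3 * ((s' - s) * (s' - s)),
      Rabs (3 * pospart s' ^ 2 - 3 * pospart s ^ 2 - 6 * pospart s * (s' - s)) <=
        3 * ((s' - s) * (s' - s)),
      Rabs (3 * pospart s' ^ 2 - 3 * pospart s ^ 2) <= 6 * Rabs (s' - s)
    & Rabs (6 * pospart s' - 6 * pospart s) <= 6 * Rabs (s' - s)].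
Proof.
move=> s1 s'1.
have h1 : Rabs (6 * pospart s' - 6 * pospart s) <= 6 * Rabs (s' - s).
  rewrite /Rabs; case: (pospart_cases s) => -[a ->]; case: (pospart_cases s') => -[b ->];
    case: Rcase_abs => ?; case: Rcase_abs => ?; lra.
have b0 t : t <= 1 -> 0 <= pospart t <= 1.
  by move=> t1; case: (pospart_cases t) => -[a ->]; lra.
have [p0 p1] := b0 s s1; have [q0 q1] := b0 s' s'1.
split=> //; last 1 first.
- have -> : 3 * pospart s' ^ 2 - 3 * pospart s ^ 2 =
    (pospart s' + pospart s) / 2 * (6 * pospart s' - 6 * pospart s) by field.
  rewrite Rabs_mult (Rabs_pos_eq (_ / 2)); last lra.
  have := Rabs_pos (6 * pospart s' - 6 * pospart s); nra.
- have sq : 0 <= (s' - s) * (s' - s) by exact: Rle_0_sqr.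
  clear h1 p0 p1 q0 q1.
  case: (pospart_cases s) => -[a ->]; case: (pospart_cases s') => -[b ->].
  + have -> : s' ^ 3 - s ^ 3 - 3 * s ^ 2 * (s' - s) = (s' + 2 * s) * ((s' - s) * (s' - s)) by ring.
    by rewrite Rabs_pos_eq; [apply: Rmult_le_compat_r; lra | apply: Rmult_le_pos; lra].
  + have -> : 0 ^ 3 - s ^ 3 - 3 * s ^ 2 * (s' - s) = (s * s) * (2 * s - 3 * s') by ring.
    have ss : 0 <= s * s by nra.
    have st : 0 <= s * - s' by nra.
    have tt : 0 <= s' * s' by nra.
    rewrite Rabs_pos_eq; last by apply: Rmult_le_pos; lra.
    have : s * s * s <= s * s * 1 by apply: Rmult_le_compat_l.
    have : s * (s * - s') <= 1 * (s * - s') by apply: Rmult_le_compat_r.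
    lra.
  + have -> : s' ^ 3 - 0 ^ 3 - 3 * 0 ^ 2 * (s' - s) = s' * (s' * s') by ring.
    have ss : 0 <= s' * s' by nra.
    rewrite Rabs_pos_eq; last by apply: Rmult_le_pos; lra.
    have : s' * (s' * s') <= 1 * (s' * s') by apply: Rmult_le_compat_r.
    nra.
  + have -> : 0 ^ 3 - 0 ^ 3 - 3 * 0 ^ 2 * (s' - s) = 0 by ring.
    by rewrite Rabs_R0; lra.
- have sq : 0 <= (s' - s) * (s' - s) by exact: Rle_0_sqr.
  have tt : 0 <= s' * s' by exact: Rle_0_sqr.
  have ss : 0 <= s * s by exact: Rle_0_sqr.
  clear h1 p0 p1 q0 q1.
  case: (pospart_cases s) => -[a ->]; case: (pospart_cases s') => -[b ->]; apply: Rabs_le_of;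
    first [lra | nra].
Qed.
End UniformC2.

(** * Bump functions with C2 bounds uniform in centre and radius *)

Section Majorant.
Context {n : nat}.
Implicit Types (x y z e p q : vec n) (phi psi : vec n -> R) (Om : vec n -> Prop).

Lemma Rabs_mult_le a b A B : Rabs a <= A -> Rabs b <= B -> Rabs (a * b) <= A * B.
Proof. by move=> h1 h2; rewrite Rabs_mult; apply: Rmult_le_compat => //; exact: Rabs_pos. Qed.

Lemma Rabs_plus_le a b A B : Rabs a <= A -> Rabs b <= B -> Rabs (a + b) <= A + B.
Proof. by move=> h1 h2; apply: Rle_trans (Rabs_triang _ _) _; lra. Qed.

(** The cube is the least integer power of the positive part with a Lipschitz second derivative, as
    the last clause of [unif_C2] demands. *)
Definition bump q (r : R) x : R := pospart (r * r - sqdist q x) ^ 3.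

Definition Dbump q (r : R) x : vec n :=
  fun i => -2 * (3 * pospart (r * r - sqdist q x) ^ 2) * vsub x q i.

Definition D2bump q (r : R) x (i j : 'I_n) : R :=
  4 * (6 * pospart (r * r - sqdist q x)) * vsub x q i * vsub x q j +
  (if j == i then -2 * (3 * pospart (r * r - sqdist q x) ^ 2) else 0).

(** Since the constant does not depend on centre and radius, a series of bumps inherits a C2 bound
    as soon as its coefficients are summable. *)
Lemma bump_unif_C2 (B : R) : 1 <= B -> exists C, 0 < C /\
  forall Om q r, 0 <= r <= 1 -> (forall x, Om x -> vdist x q <= B - 1) ->
    unif_C2 Om C (bump q r) (Dbump q r) (D2bump q r).
Proof.
(* [B] bounds the distance to [q] also at points within 1 of [Om], and [E] is a Lipschitz constant
   there for the argument of the positive part. The six summands of [M] bound the six estimates in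
   order. *)
move=> B1; set E := 2 * B + 1.
set M := 1 + 6 * B + (24 * (B * B) + 6) + (3 * (E * E) + 3)
  + 2 * (6 * E + B * (3 * (E * E)) + 6 * B) + (4 * (6 * E * (B * B) + 12 * B) + 12 * E).
have BB : 1 <= B * B by nra.
have E1 : 1 <= E by rewrite /E; lra.
have EE : 1 <= E * E by nra.
have BEE : 0 <= B * (3 * (E * E)) by apply: Rmult_le_pos; lra.
have EBB : 0 <= 6 * E * (B * B) by apply: Rmult_le_pos; lra.
exists M; split; first by rewrite /M; lra.
move=> Om q r r1 HB x y Ox yx.
have xq : vdist x q <= B by have := HB x Ox; lra.
have yq : vdist y q <= B by have := vdist_triangle x y q; have := HB x Ox; lra.
have D0 := vdist_ge0 y x; set D := vdist y x in yx D0 *.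
have DD : 0 <= D * D <= D by nra.
have wB z i : vdist z q <= B -> Rabs (vsub z q i) <= B.
  by move=> h; apply: Rle_trans (coord_le_vnorm _ _) h.
have vD i : Rabs (vsub y x i) <= D by exact: coord_le_vnorm.
rewrite /bump /Dbump /D2bump.
have sle z : r * r - sqdist q z <= 1 by have := dot_ge0 (vsub z q); rewrite /sqdist; nra.
have pp z : 0 <= pospart (r * r - sqdist q z) <= 1.
  by case: (pospart_cases (r * r - sqdist q z)) => -[a ->]; have := sle z; lra.
have se := sqdistE q x y; rewrite -[dot (vsub y x) (vsub y x)]vnorm_sqr -/(vdist y x) -/D in se.
have cs := cauchy_schwarz (vsub x q) (vsub y x).
have csb : Rabs (dot (vsub x q) (vsub y x)) <= B * D.
  by apply: Rle_trans cs _; apply: Rmult_le_compat; try exact: vnorm_ge0; [exact: xq | exact: Rle_refl].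
have [t1 t2 t3 t4] := pospart_cube_taylor _ _ (sle x) (sle y).
move: t1 t2 t3 t4.
set s' := r * r - sqdist q y; set s := r * r - sqdist q x.
set W := dot (vsub x q) (vsub y x) in csb se.
have ee : s' - s = - (2 * W + D * D) by rewrite /s' /s se; ring.
set dl := s' - s in ee *.
have dE : Rabs dl <= E * D.
  rewrite ee Rabs_Ropp; apply: Rle_trans (_ : _ <= 2 * (B * D) + D * D) _; last by rewrite /E; lra.
  by apply: Rabs_plus_le; [apply: Rabs_mult_le => //|]; rewrite Rabs_pos_eq; lra.
have dd : dl * dl <= E * E * (D * D).
  rewrite -(Rabs_pos_eq (dl * dl)); last exact: Rle_0_sqr.
  by have := Rabs_mult_le _ _ _ _ dE dE; lra.
have p0 := pp x; have q0 := pp y; rewrite -/s in p0; rewrite -/s' in q0.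
move: p0 q0; set P := pospart s; set P' := pospart s' => p0 q0 t1 t2 t3 t4.
have PP : 0 <= P ^ 2 <= 1 by nra.
have PP' : 0 <= P' ^ 2 <= 1 by nra.
have P3' : 0 <= P' ^ 3 <= 1 by rewrite /= in PP' *; nra.
have t1' : Rabs (P' ^ 3 - P ^ 3 - 3 * P ^ 2 * dl) <= 3 * (E * E) * (D * D) by lra.
have t2' : Rabs (3 * P' ^ 2 - 3 * P ^ 2 - 6 * P * dl) <= 3 * (E * E) * (D * D) by lra.
have t3' : Rabs (3 * P' ^ 2 - 3 * P ^ 2) <= 6 * E * D by lra.
have t4' : Rabs (6 * P' - 6 * P) <= 6 * E * D by lra.
have dDD : Rabs (D * D) <= D * D by rewrite Rabs_pos_eq; lra.
split; first split.
- by rewrite Rabs_pos_eq; rewrite /M; lra.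
- move=> i; apply: Rle_trans (_ : _ <= 6 * B) _; last by rewrite /M; lra.
  apply: Rabs_mult_le; last exact: wB.
  by rewrite Rabs_left1; lra.
- move=> i j; apply: Rle_trans (_ : _ <= 24 * (B * B) + 6) _; last by rewrite /M; lra.
  apply: Rabs_plus_le; last by case: (j == i); [rewrite Rabs_left1; lra | rewrite Rabs_R0; lra].
  rewrite Rmult_assoc; apply: Rabs_mult_le; first by rewrite Rabs_pos_eq; lra.
  by apply: Rabs_mult_le; exact: wB.
- apply: Rle_trans (_ : _ <= (3 * (E * E) + 3) * (D * D)) _.
    rewrite dot_scall -/W.
    (* The remainder is that of the cube for the increment [dl], plus the contribution of the
       quadratic part of the increment of [sqdist]. *)
    have -> : P' ^ 3 - P ^ 3 - -2 * (3 * P ^ 2) * W =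
      (P' ^ 3 - P ^ 3 - 3 * P ^ 2 * dl) + - (3 * P ^ 2) * (D * D) by rewrite ee; ring.
    have : Rabs (- (3 * P ^ 2) * (D * D)) <= 3 * (D * D).
      by apply: Rabs_mult_le => //; rewrite Rabs_left1; lra.
    by move=> h; have := Rabs_plus_le _ _ _ _ t1' h; lra.
  by apply: Rmult_le_compat_r; rewrite /M; lra.
- move=> i; apply: Rle_trans (_ : _ <= (2 * (6 * E + B * (3 * (E * E)) + 6 * B)) * (D * D)) _.
    have -> : dot (fun j => 4 * (6 * P) * vsub x q i * vsub x q j +
       (if j == i then -2 * (3 * P ^ 2) else 0)) (vsub y x) =
       4 * (6 * P) * vsub x q i * W + -2 * (3 * P ^ 2) * vsub y x i.
      rewrite -(dot_one i (vsub y x)) -[_ * W]dot_scall /dot -big_split; apply: eq_bigr => j _ /=; ring.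
    have -> : -2 * (3 * P' ^ 2) * vsub y q i - -2 * (3 * P ^ 2) * vsub x q i -
      (4 * (6 * P) * vsub x q i * W + -2 * (3 * P ^ 2) * vsub y x i) =
      -2 * ((3 * P' ^ 2 - 3 * P ^ 2) * vsub y x i +
            vsub x q i * (3 * P' ^ 2 - 3 * P ^ 2 - 6 * P * dl)
            + - (6 * P) * vsub x q i * (D * D)).
      by rewrite ee /vsub; ring.
    have -> : 2 * (6 * E + B * (3 * (E * E)) + 6 * B) * (D * D) =
      2 * (6 * E * D * D + B * (3 * (E * E) * (D * D)) + 6 * B * (D * D)) by ring.
    apply: Rabs_mult_le; first by rewrite Rabs_left1; lra.
    apply: Rabs_plus_le; first apply: Rabs_plus_le; apply: Rabs_mult_le => //; try exact: wB.
    by apply: Rabs_mult_le; [rewrite Rabs_left1; lra | exact: wB].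
  by apply: Rmult_le_compat_r; rewrite /M; lra.
- move=> i j; apply: Rle_trans (_ : _ <= (4 * (6 * E * (B * B) + 12 * B) + 12 * E) * D) _.
    have -> : 4 * (6 * P') * vsub y q i * vsub y q j +
       (if j == i then -2 * (3 * P' ^ 2) else 0) -
      (4 * (6 * P) * vsub x q i * vsub x q j + (if j == i then -2 * (3 * P ^ 2) else 0)) =
      4 * ((6 * P' - 6 * P) * (vsub y q i * vsub y q j) +
           6 * P * (vsub y x i * vsub y q j + vsub x q i * vsub y x j)) +
      (if j == i then -2 else 0) * (3 * P' ^ 2 - 3 * P ^ 2).
      by rewrite /vsub; case: (j == i); ring.
    have -> : (4 * (6 * E * (B * B) + 12 * B) + 12 * E) * D =
       4 * (6 * E * D * (B * B) + 6 * (D * B + B * D)) + 2 * (6 * E * D) by ring.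
    apply: Rabs_plus_le; apply: Rabs_mult_le => //; first by rewrite Rabs_pos_eq; lra.
      apply: Rabs_plus_le; apply: Rabs_mult_le => //.
      - by apply: Rabs_mult_le; exact: wB.
      - by rewrite Rabs_pos_eq; lra.
      - by apply: Rabs_plus_le; apply: Rabs_mult_le => //; exact: wB.
    by case: (j == i); [rewrite Rabs_left1; lra | rewrite Rabs_R0; lra].
  by apply: Rmult_le_compat_r; rewrite /M; lra.
Qed.

Lemma bump_ge0 q r x : 0 <= bump q r x.
Proof. by rewrite /bump; apply: pow_le; exact: Rmax_l. Qed.

Lemma bump_le1 q r x : 0 <= r <= 1 -> bump q r x <= 1.
Proof.
move=> r1; have d0 := dot_ge0 (vsub x q).
have : 0 <= pospart (r * r - sqdist q x) <= 1.
  by case: (pospart_cases (r * r - sqdist q x)) => -[a ->]; rewrite /sqdist in a *; nra.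
by rewrite /bump => h; have := pow_incr _ _ 3 h; rewrite pow1.
Qed.

Lemma bump_gt0 q r x : vdist x q < r -> 0 < bump q r x.
Proof.
move=> h; apply: pow_lt; apply: Rlt_le_trans (Rmax_r _ _).
by have := vdist_ge0 x q; rewrite /sqdist -vdist_sqr; nra.
Qed.

Lemma bump_eq0 q r x : 0 <= r -> r <= vdist x q -> bump q r x = 0.
Proof.
move=> r0 h; rewrite /bump /pospart Rmax_left; first by ring.
by rewrite /sqdist -vdist_sqr; nra.
Qed.
End Majorant.

(** * Countable families of balls, C2 majorants and localization of test functions *)

Section Localization.
Context {n : nat}.
Implicit Types (x y z e p q : vec n) (phi psi v : vec n -> R) (Om : vec n -> Prop).

Lemma unif_C2_le Om C C' phi Dphi D2phi : C <= C' ->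
  unif_C2 Om C phi Dphi D2phi -> unif_C2 Om C' phi Dphi D2phi.
Proof.
move=> CC H x y Ox yx; case: (H x y Ox yx) => -[h1 h2] h3 h4 h5 h6.
have D0 := vdist_ge0 y x; have DD : 0 <= vdist y x * vdist y x by exact: Rle_0_sqr.
have sc a t : 0 <= t -> Rabs a <= C * t -> Rabs a <= C' * t.
  by move=> t0 h; apply: Rle_trans h _; apply: Rmult_le_compat_r.
split; [split=> [|i]|move=> i j| |move=> i|move=> i j]; apply: sc => //; lra.
Qed.

Lemma Series_ge_term (a : nat -> R) N : ex_series a -> (forall k, 0 <= a k) -> a N <= Series a.
Proof.
move=> ea a0; have /is_series_Reals h := Series_correct _ ea.
apply: Rle_trans (sum_incr _ N _ h a0).
by case: N => [|N] /=; [lra | have := cond_pos_sum a N a0; lra].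
Qed.

Lemma half_series : ex_series (fun k => (1 / 2) ^ k.+1) /\ Series (fun k => (1 / 2) ^ k.+1) = 1.
Proof.
have h : Rabs (1 / 2) < 1 by rewrite Rabs_pos_eq; lra.
have e : is_series (fun k => (1 / 2) ^ k.+1) (1 / 2 * / (1 - 1 / 2)).
  exact: (is_series_scal_l (1 / 2) _ _ (is_series_geom _ h)).
split; first by eexists; exact: e.
by rewrite (is_series_unique _ _ e); field.
Qed.

(** Rational points coded by natural numbers, so that [pickle] enumerates them; the shift by [M]
    reaches negative coordinates. *)
Definition grid_point (M : R) (zm : {ffun 'I_n -> nat} * nat) : vec n :=
  fun i => INR (zm.1 i) / INR zm.2.+1 - M.

(** Rounding down every coordinate moves a point by at most [n / (m + 1)], by [vnorm_le_sum]; [n.+1]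
    makes the inclusion in the ball strict, also for [n = 0]. *)
Definition grid_radius (zm : {ffun 'I_n -> nat} * nat) : R := INR n.+1 / INR zm.2.+1.

Lemma grid_radius_gt0 zm : 0 < grid_radius zm.
Proof. by apply: Rdiv_lt_0_compat; apply: lt_0_INR; lia. Qed.

Lemma grid_dense (M rho : R) x : 0 < rho -> vnorm x <= M ->
  exists zm, grid_radius zm < rho /\ vdist x (grid_point M zm) < grid_radius zm.
Proof.
move=> rho0 xM; have [m hm] := INR_unbounded (INR n.+1 / rho).
have m0 : 0 < INR m.+1 by apply: lt_0_INR; lia.
have fl i : exists k : nat, INR k <= (x i + M) * INR m.+1 < INR k + 1.
  have h : 0 <= (x i + M) * INR m.+1.
    apply: Rmult_le_pos; last lra.
    by have := coord_le_vnorm x i; have := Rle_abs (- x i); rewrite Rabs_Ropp; lra.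
  by have [k hk] := nfloor_ex _ h; exists k.
pose z := [ffun i => proj1_sig (constructive_indefinite_description _ (fl i))] : {ffun 'I_n -> nat}.
have hz i : INR (z i) <= (x i + M) * INR m.+1 < INR (z i) + 1.
  by rewrite ffunE; case: constructive_indefinite_description.
exists (z, m); split; rewrite /grid_radius -[(z, m).2]/m.
  apply: (Rmult_lt_reg_r (INR m.+1)) => //; rewrite /Rdiv Rmult_assoc Rinv_l; last lra.
  have : INR n.+1 / rho * rho < INR m.+1 * rho.
    by apply: Rmult_lt_compat_r => //; rewrite (S_INR m); lra.
  by rewrite /Rdiv Rmult_assoc Rinv_l; lra.
have im : 0 < / INR m.+1 by exact: Rinv_0_lt_compat.
apply: Rle_lt_trans (_ : INR n * / INR m.+1 < _); last first.
  by rewrite /Rdiv (S_INR n); apply: Rmult_lt_compat_r => //; lra.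
apply: vnorm_le_sum; last lra.
move=> i; rewrite /vsub /grid_point -[(z, m).2]/m -[(z, m).1]/z.
have -> : x i - (INR (z i) / INR m.+1 - M) =
  ((x i + M) * INR m.+1 - INR (z i)) * / INR m.+1 by field; lra.
have h := hz i; rewrite Rabs_pos_eq; last by apply: Rmult_le_pos; lra.
by rewrite -[X in _ <= X]Rmult_1_l; apply: Rmult_le_compat_r; lra.
Qed.

(* [G] is the inverse of a positive function of the form [sum_k c_k bump_k], the bumps
   ranging over a countable base of balls on which [v] is bounded: the freedom to take
   the [c_k] as small as needed replaces a partition of unity. *)
Lemma C2_majorant Om v : is_open Om -> is_bounded Om -> cont_on Om v ->
  exists G DG D2G, is_C2 Om G DG D2G /\ forall x, Om x -> Rabs (v x) <= G x.
Proof.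
move=> oOm [M0 bOm] cv.
pose M := Rmax 0 M0; have M_ge0 : 0 <= M by exact: Rmax_l.
have bM x : Om x -> vnorm x <= M by move=> /bOm h; apply: Rle_trans h (Rmax_r _ _).
have bdist x y : Om x -> Om y -> vdist x y <= (2 * M + 1) - 1.
  move=> /bM hx /bM hy; have := vnorm_triangle x y (-1).
  by rewrite -vsubE -/(vdist x y) Rabs_Ropp Rabs_R1; lra.
have [C [C0 HC]] := bump_unif_C2 (n := n) (2 * M + 1) ltac:(lra).
pose good zm K := 0 <= K /\ grid_radius zm <= 1 /\
  forall y, vdist y (grid_point M zm) < grid_radius zm -> Om y /\ Rabs (v y) <= K.
(* If the [k]-th ball is good, its bump is scaled by [2^-(k+1) / (1 + K)], which controls both its
   C2 constant and its product with [1 + |v|]. All other terms are zero. *)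
have term k : exists T : (vec n -> R) * (vec n -> vec n) * (vec n -> 'I_n -> 'I_n -> R),
  [/\ unif_C2 Om ((1 / 2) ^ k.+1 * C) T.1.1 T.1.2 T.2,
      forall x, Om x -> 0 <= T.1.1 x,
      forall x, Om x -> T.1.1 x * (1 + Rabs (v x)) <= (1 / 2) ^ k.+1
    & forall zm K, unpickle k = Some zm -> good zm K ->
        forall x, vdist x (grid_point M zm) < grid_radius zm -> 0 < T.1.1 x].
  have h0 : 0 < (1 / 2) ^ k.+1 by apply: pow_lt; lra.
  move: ((1 / 2) ^ k.+1) h0 => hk h0.
  case: (classic (exists zm K, unpickle k = Some zm /\ good zm K)); last first.
    move=> nex; exists (fun _ => 0, fun _ _ => 0, fun _ _ _ => 0); split=> //=.
    - have c0 : 0 <= hk * C by nra.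
      move=> x y Ox yx; have D0 := vdist_ge0 y x.
      have DD : 0 <= vdist y x * vdist y x by exact: Rle_0_sqr.
      have dz : dot (fun _ => 0) (vsub y x) = 0 by rewrite /dot big1 // => i _; ring.
      have nn t : 0 <= t -> 0 <= hk * C * t by exact: Rmult_le_pos.
      by split; [split=> [|i]|move=> i j| |move=> i|move=> i j];
        rewrite ?dz ?Rminus_diag ?Rminus_diag Rabs_R0; apply: nn => //; lra.
    - by move=> x _; lra.
    - by move=> x _; lra.
    - by move=> zm K e gd; case: nex; exists zm, K.
  move=> [zm [K [ezm [K0 [r1 gd]]]]].
  have r0 := grid_radius_gt0 zm.
  have cK : 0 < hk / (1 + K) by apply: Rdiv_lt_0_compat; lra.
  have cK' : hk / (1 + K) * (1 + K) = hk by field; lra.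
  set c := _ / _ in cK cK'; set q := grid_point M zm in gd.
  have Oq : Om q by apply: (proj1 (gd q _)); rewrite vdist_refl.
  exists (fun x => c * bump q (grid_radius zm) x, fun x i => c * Dbump q (grid_radius zm) x i,
     fun x i j => c * D2bump q (grid_radius zm) x i j); split=> /=.
  - apply: (unif_C2_le _ (c * C)); first by apply: Rmult_le_compat_r; nra.
    by apply: unif_C2_scal; [lra | apply: HC => [|x Ox]; [lra | exact: bdist]].
  - by move=> x _; have := bump_ge0 q (grid_radius zm) x; nra.
  - move=> x Ox; case: (Rlt_dec (vdist x q) (grid_radius zm)) => [h|h].
      have [_ vK] := gd x h.
      have b1 := bump_le1 q (grid_radius zm) x ltac:(lra); have b0 := bump_ge0 q (grid_radius zm) x.
      have v0 := Rabs_pos (v x); rewrite -cK' Rmult_assoc.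
      by apply: Rmult_le_compat_l; [lra | nra].
    by rewrite bump_eq0; lra.
  - move=> zm' K'; rewrite ezm => -[<-] _ x /bump_gt0 h.
    exact: Rmult_lt_0_compat.
pose T k := proj1_sig (constructive_indefinite_description _ (term k)).
have HT k : [/\ unif_C2 Om ((1 / 2) ^ k.+1 * C) (T k).1.1 (T k).1.2 (T k).2,
      forall x, Om x -> 0 <= (T k).1.1 x,
      forall x, Om x -> (T k).1.1 x * (1 + Rabs (v x)) <= (1 / 2) ^ k.+1
    & forall zm K, unpickle k = Some zm -> good zm K ->
        forall x, vdist x (grid_point M zm) < grid_radius zm -> 0 < (T k).1.1 x].
  by rewrite /T; case: constructive_indefinite_description.
clearbody T; have [eh sh] := half_series.
have eC : ex_series (fun k => (1 / 2) ^ k.+1 * C) by exact: ex_series_scal_r.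
have HU k : unif_C2 Om ((1 / 2) ^ k.+1 * C) (T k).1.1 (T k).1.2 (T k).2 by case: (HT k).
have HH := unif_C2_is_C2 _ _ _ _ _ (unif_C2_series Om _ (fun k => (T k).1.1)
  (fun k => (T k).1.2) (fun k => (T k).2) eC HU).
set H := (fun x => Series _) in HH.
have exH x : Om x -> ex_series (fun k => (T k).1.1 x).
  move=> Ox; apply: (proj1 (Series_Rabs_le _ _ 1 eh _)) => k.
  have [_ /(_ _ Ox) h1 /(_ _ Ox) h2 _] := HT k; move: h2; set hk := (_ ^ _) => h2.
  have h3 := Rmult_le_pos _ _ h1 (Rabs_pos (v x)).
  by rewrite Rabs_pos_eq ?Rmult_1_r; [lra | exact: h1].
have Hgt0 x : Om x -> 0 < H x.
  move=> Ox; have [r [r0 hr]] := oOm x Ox; have [d [d0 hd]] := cv x Ox 1 Rlt_0_1.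
  (* A grid ball of radius below [rho] containing [x] stays within [2 * rho] of [x], hence the
     halves. *)
  pose rho := Rmin 1 (Rmin (r / 2) (d / 2)).
  have rho0 : 0 < rho by do 2?apply: Rmin_pos; lra.
  have [zm [h1 h2]] := grid_dense M rho x rho0 (bM _ Ox).
  have m1 : rho <= 1 by exact: Rmin_l.
  have m2 : rho <= r / 2 by apply: Rle_trans (Rmin_r _ _) (Rmin_l _ _).
  have m3 : rho <= d / 2 by apply: Rle_trans (Rmin_r _ _) (Rmin_r _ _).
  have gd : good zm (Rabs (v x) + 1).
    split; first by have := Rabs_pos (v x); lra.
    split=> [|y hy]; first lra.
    have yx : vdist y x < 2 * rho.
      by have := vdist_triangle (grid_point M zm) y x; rewrite [vdist (grid_point _ _) x]vdist_sym; lra.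
    have Oy : Om y by apply: hr; rewrite -/(vdist y x); lra.
    split=> //; have h := hd y Oy; rewrite -/(vdist y x) in h.
    have := h ltac:(lra); have := Rabs_triang (v y - v x) (v x).
    have -> : v y - v x + v x = v y by ring.
    by move=> *; lra.
  have [_ _ _ /(_ zm _ (pickleK zm) gd x h2) pos] := HT (pickle zm).
  apply: Rlt_le_trans pos _; apply: (Series_ge_term (fun k => (T k).1.1 x)); first exact: exH.
  by move=> k; have [_ /(_ _ Ox)] := HT k.
(* The weights sum to 1; this bound is what makes [/ H] a majorant. *)
have Hle x : Om x -> H x * (1 + Rabs (v x)) <= 1.
  move=> Ox; rewrite -[X in _ <= X]sh /H -Series_scal_r; apply: Series_le eh => k.
  have [_ /(_ _ Ox) h1 /(_ _ Ox) h2 _] := HT k; split; last exact: h2.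
  by apply: Rmult_le_pos h1 _; have := Rabs_pos (v x); lra.
clearbody H; have C2G := is_C2_comp _ (fun t => / t) (fun t => - / (t * t)) (fun t => 2 / (t * t * t)) _ _ _ HH.
exists (fun x => / H x); eexists; eexists; split; [apply: C2G|].
- by move=> x /Hgt0 h; apply/is_derive_Reals; auto_derive; [lra | field; lra].
- move=> x /Hgt0 h; apply/is_derive_Reals; auto_derive; last by field; lra.
  by apply: Rmult_integral_contrapositive; split; lra.
- move=> x /Hgt0 h; apply: derivable_continuous_pt.
  eexists; apply/is_derive_Reals; auto_derive; last by [].
  by repeat (apply: Rmult_integral_contrapositive_currified); lra.
- move=> x Ox; have h := Hgt0 x Ox; have h1 := Hle x Ox.
  apply: (Rmult_le_reg_l (H x)) => //; rewrite Rinv_r; last lra.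
  lra.
Qed.

(** [W] is [|x - xb|^4 G / d^4] with [G] a majorant of [|v|]. The fourth power makes value, gradient
    and Hessian vanish at [xb]; within distance [d] one has [v <= 0 <= W], and beyond it the factor
    of [G] is at least 1. *)
Lemma C2_localize Om xb d v : is_open Om -> is_bounded Om -> 0 < d -> cont_on Om v ->
  (forall x, Om x -> vdist x xb < d -> v x <= 0) ->
  exists W DW D2W, [/\ is_C2 Om W DW D2W, W xb = 0 /\ (forall i, DW xb i = 0),
    forall i j, D2W xb i j = 0 & forall x, Om x -> v x <= W x].
Proof.
move=> oOm bOm d0 cv vle; have [G [DG [D2G [C2G Gv]]]] := C2_majorant Om v oOm bOm cv.
pose c := / (d * d * (d * d)).
have dd : 0 < d * d * (d * d) by repeat apply: Rmult_lt_0_compat.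
have c0 : 0 < c by exact: Rinv_0_lt_compat.
have C2s := is_C2_comp Om (fun t => c * (t * t)) (fun t => 2 * c * t) (fun _ => 2 * c) _ _ _
  (is_C2_sqdist Om xb).
have C2q := C2s _ _ _; have C2W := is_C2_mult _ _ _ _ _ _ _ (C2q _ _ _) C2G.
have s0 : sqdist xb xb = 0 by rewrite /sqdist -vdist_sqr vdist_refl; ring.
have w0 i : vsub xb xb i = 0 by rewrite /vsub; ring.
exists (fun x => c * (sqdist xb x * sqdist xb x) * G x); eexists; eexists; split.
- apply: C2W => x _.
  + by apply/is_derive_Reals; auto_derive => //; ring.
  + by apply/is_derive_Reals; auto_derive => //; ring.
  + by apply: continuity_pt_const.
- by split=> [|i]; rewrite s0 ?w0; ring.
- by move=> i j; rewrite /= s0 !w0; ring.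
- move=> x Ox; have gv := Gv x Ox; have v0 := Rabs_pos (v x); have v1 := Rle_abs (v x).
  have ss : 0 <= sqdist xb x * sqdist xb x by exact: Rle_0_sqr.
  case: (Rlt_dec (vdist x xb) d) => h.
    apply: Rle_trans (vle x Ox h) _.
    by apply: Rmult_le_pos; [apply: Rmult_le_pos|]; lra.
  have h1 : d * d <= sqdist xb x by rewrite /sqdist -vdist_sqr; nra.
  have h2 : d * d * (d * d) <= sqdist xb x * sqdist xb x.
    by have := Rmult_lt_0_compat _ _ d0 d0; nra.
  have : c * (d * d * (d * d)) = 1 by rewrite /c Rinv_l; lra.
  have : c * (d * d * (d * d)) <= c * (sqdist xb x * sqdist xb x).
    by apply: Rmult_le_compat_l; lra.
  by nra.
Qed.
End Localization.

(** * Compactness of closed balls *)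

Section Compactness.
Context {n : nat}.
Implicit Types (x y z e p q : vec n) (phi psi v : vec n -> R) (Om : vec n -> Prop).

(** The extraction [tau] need not be monotone: [k <= tau k] is stable under composition and suffices
    for passing to limits. *)
Lemma bounded_seq_cluster (un : nat -> R) M : (forall k, Rabs (un k) <= M) ->
  exists (tau : nat -> nat) l, (forall k, (k <= tau k)%N) /\
    forall k, Rabs (un (tau k) - l) < / INR k.+1.
Proof.
move=> H; have [k|l Hl] := Bolzano_Weierstrass un _ (compact_P3 (- M) M).
  by split; have := H k; have := Rle_abs (un k); have := Rle_abs (- un k); rewrite Rabs_Ropp; lra.
have ex k : exists j : nat, (k <= j)%N /\ Rabs (un j - l) < / INR k.+1.
  have k0 : 0 < / INR k.+1 by apply: Rinv_0_lt_compat; apply: lt_0_INR; lia.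
  have [j [kj hj]] := Hl (disc l (mkposreal _ k0)) k ltac:(exists (mkposreal _ k0); exact).
  by exists j; split=> //; apply/leP.
exists (fun k => proj1_sig (constructive_indefinite_description _ (ex k))), l.
by split=> k; case: constructive_indefinite_description => j [].
Qed.

Lemma inv_INR_lt eps : 0 < eps -> exists N : nat, forall k, (N <= k)%N -> / INR k.+1 < eps.
Proof.
move=> eps0; have [N hN] := INR_unbounded (/ eps); exists N => k /leP kN.
rewrite -(Rinv_inv eps); apply: Rinv_lt_contravar.
  by apply: Rmult_lt_0_compat; [exact: Rinv_0_lt_compat | apply: lt_0_INR; lia].
by apply: Rlt_trans hN _; apply: lt_INR; lia.
Qed.

Lemma bounded_vec_seq_cluster (X : nat -> vec n) M : (forall k, vnorm (X k) <= M) ->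
  exists (sg : nat -> nat) x, (forall k, (k <= sg k)%N) /\
    forall eps, 0 < eps -> exists N, forall k, (N <= k)%N -> vdist (X (sg k)) x < eps.
Proof.
move=> bX.
(* Successive extraction: the first [m] coordinates converge, by induction on [m]. *)
have coordwise (m : nat) : (m <= n)%N -> exists (sg : nat -> nat) x, (forall k, (k <= sg k)%N) /\
    forall i : 'I_n, (i < m)%N -> forall eps, 0 < eps ->
      exists N, forall k, (N <= k)%N -> Rabs (X (sg k) i - x i) < eps.
  elim: m => [|m IH] mn; first by exists id, (fun _ => 0).
  have [sg [x [sgk hx]]] := IH (ltnW mn).
  pose i0 := Ordinal mn.
  have bk k : Rabs (X (sg k) i0) <= M by apply: Rle_trans (coord_le_vnorm _ _) (bX _).
  have [tau [l [tauk hl]]] := bounded_seq_cluster _ _ bk.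
  exists (fun k => sg (tau k)), (fun i => if i == i0 then l else x i).
  split=> [k|i im eps eps0]; first exact: leq_trans (tauk k) (sgk _).
  case: eqP => [->|ne].
    have [N hN] := inv_INR_lt _ eps0; exists N => k /hN; have := hl k; lra.
  have im' : (i < m)%N.
    move: im; rewrite ltnS leq_eqVlt => /orP[/eqP e|//].
    by case: ne; apply: val_inj.
  have [N hN] := hx i im' _ eps0; exists N => k Nk; apply: hN.
  exact: leq_trans Nk (tauk k).
have [sg [x [sgk hx]]] := coordwise n (leqnn n).
exists sg, x; split=> // eps eps0.
have d0 : 0 < eps / INR n.+1 by apply: Rdiv_lt_0_compat => //; apply: lt_0_INR; lia.
have ex i := hx i (ltn_ord i) _ d0.
pose N i := proj1_sig (constructive_indefinite_description _ (ex i)).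
have hN i k : (N i <= k)%N -> Rabs (X (sg k) i - x i) < eps / INR n.+1.
  by rewrite /N; case: constructive_indefinite_description => j; apply.
exists (\max_i N i) => k Nk.
apply: Rle_lt_trans (_ : INR n * (eps / INR n.+1) < _).
  apply: vnorm_le_sum => [i|]; last lra.
  by apply: Rlt_le; apply: hN; apply: leq_trans Nk; exact: leq_bigmax.
have -> : INR n * (eps / INR n.+1) = eps - eps / INR n.+1.
  by rewrite S_INR; field; have := pos_INR n; lra.
lra.
Qed.

Lemma ball_max q h phi : 0 <= h -> cont_on (fun x => vdist x q <= h) phi ->
  exists xb, vdist xb q <= h /\ forall y, vdist y q <= h -> phi y <= phi xb.
Proof.
move=> h0 cphi.
(* Composing with the bounded increasing [atan] yields a finite supremum before [phi] is known to be
   bounded. *)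
have catan : cont_on (fun x => vdist x q <= h) (fun x => atan (phi x)).
  by apply: cont_on_comp => // x _; apply: derivable_continuous_pt; exact: derivable_pt_atan.
have qq : vdist q q <= h by rewrite vdist_refl.
have [s [ub lub]] : { s | is_lub (fun t => exists y, vdist y q <= h /\ t = atan (phi y)) s }.
  apply: completeness.
    by exists (PI / 2) => t [y [_ ->]]; have := atan_bound (phi y); lra.
  by exists (atan (phi q)), q.
have ex k : exists y, vdist y q <= h /\ s - / INR k.+1 < atan (phi y).
  apply: NNPP => nex; have k0 : 0 < / INR k.+1 by apply: Rinv_0_lt_compat; apply: lt_0_INR; lia.
  suff : s <= s - / INR k.+1 by lra.
  apply: lub => t [y [yq ->]]; apply: Rnot_lt_le => lt.
  by apply: nex; exists y.
pose X k := proj1_sig (constructive_indefinite_description _ (ex k)).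
have hX k : vdist (X k) q <= h /\ s - / INR k.+1 < atan (phi (X k)).
  by rewrite /X; case: constructive_indefinite_description.
clearbody X; have bX k : vnorm (X k) <= h + vnorm q.
  have := vnorm_triangle (vsub (X k) q) q 1; rewrite Rabs_R1 Rmult_1_l -/(vdist (X k) q).
  have -> : vadd (vsub (X k) q) 1 q = X k.
    by apply: functional_extensionality => i; rewrite /vadd /vsub; ring.
  by have [h1 _] := hX k; rewrite /vdist in h1 *; lra.
have [sg [x [sgk cx]]] := bounded_vec_seq_cluster _ _ bX.
have xq : vdist x q <= h.
  apply: Rnot_lt_le => lt; have [N /(_ N (leqnn N)) hN] := cx (vdist x q - h) ltac:(lra).
  have := vdist_triangle (X (sg N)) x q; rewrite (vdist_sym x (X _)).
  by have := proj1 (hX (sg N)); lra.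
exists x; split=> // y yq; apply: Rnot_lt_le => /atan_increasing lt.
have gs : atan (phi y) <= s by apply: ub; exists y.
have [d [d0 hd]] := catan x xq ((s - atan (phi x)) / 2) ltac:(lra).
have [N hN] := cx d d0.
have [N' hN'] := inv_INR_lt ((s - atan (phi x)) / 2) ltac:(lra).
have Nk : (N <= maxn N N')%N by exact: leq_maxl.
have N'k : (N' <= sg (maxn N N'))%N by apply: leq_trans (leq_maxr N N') (sgk _).
have [a1 a2] := hX (sg (maxn N N')).
have := hd _ a1 (hN _ Nk); have := hN' _ N'k.
by have := Rle_abs (atan (phi (X (sg (maxn N N')))) - atan (phi x)); lra.
Qed.

Lemma cont_on_sub Om (Om' : vec n -> Prop) phi : (forall x, Om' x -> Om x) ->
  cont_on Om phi -> cont_on Om' phi.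
Proof.
move=> sub c x Ox eps eps0; have [d [d0 h]] := c x (sub x Ox) _ eps0.
by exists d; split=> // y /sub; exact: h.
Qed.

Lemma cont_on_vdist Om q : cont_on Om (fun x => vdist x q).
Proof.
move=> x _ eps eps0; exists eps; split=> // y _ yx; rewrite -/(vdist y x) in yx.
have := vdist_triangle x y q; have := vdist_triangle y x q; rewrite (vdist_sym x y) => *.
by apply: Rabs_def1; lra.
Qed.

End Compactness.

(** * Viscosity test functions and comparison with paraboloidal cones *)

Section ConeComparison.
Context {n : nat}.
Implicit Types (x y z e p q : vec n) (phi psi u h : vec n -> R) (Om : vec n -> Prop).

(** The matrix is the Hessian of [F(|x - q|^2)] as produced by [is_C2_comp], with [A = F'],
    [B = F''] and [w = x - q]. *)
Lemma quad_rank_one (A B : R) (w p : vec n) :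
  quad (fun i j => A * (if j == i then 2 else 0) + 2 * w i * (B * (2 * w j))) p =
  2 * A * dot p p + 4 * B * (dot w p * dot w p).
Proof.
rewrite /quad (eq_bigr (fun i => 2 * A * (p i * p i) + 4 * B * dot w p * (w i * p i))).
  by rewrite big_split /= !big_Rscal /dot; ring.
move=> i _.
have -> : 2 * A * (p i * p i) + 4 * B * dot w p * (w i * p i) =
  dot (fun j => if j == i then 2 * A * p i else 0) p + 4 * B * (w i * p i) * dot w p.
  by rewrite dot_one; ring.
rewrite -dot_scall /dot -big_split; apply: eq_bigr => j _ /=.
by case: eqP => _; ring.
Qed.

Lemma quad_opp (A : 'I_n -> 'I_n -> R) p : quad (fun i j => - A i j) p = - quad A p.
Proof.
rewrite /quad -[- _]Rmult_1_l Ropp_mult_distr_r_reverse Ropp_mult_distr_l -big_Rscal.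
apply: eq_bigr => i _; rewrite -big_Rscal; apply: eq_bigr => j _; ring.
Qed.

Lemma quad_oppv (A : 'I_n -> 'I_n -> R) p : quad A (fun i => - p i) = quad A p.
Proof. by apply: eq_bigr => i _; apply: eq_bigr => j _; ring. Qed.

Lemma is_C2_opp Om phi Dphi D2phi : is_C2 Om phi Dphi D2phi ->
  is_C2 Om (fun x => - phi x) (fun x i => - Dphi x i) (fun x i j => - D2phi x i j).
Proof.
move=> H; have := is_C2_comp Om (fun t => - t) (fun _ => -1) (fun _ => 0) _ _ _ H.
have -> : (fun x i => -1 * Dphi x i) = (fun x i => - Dphi x i).
  by apply: functional_extensionality => x; apply: functional_extensionality => i; ring.
have -> : (fun x i j => -1 * D2phi x i j + Dphi x i * (0 * Dphi x j)) =
  (fun x i j => - D2phi x i j).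
  by apply: functional_extensionality => x; apply: functional_extensionality => i;
    apply: functional_extensionality => j; ring.
apply=> x _; last exact: continuity_pt_const.
- by apply/is_derive_Reals; auto_derive => //; ring.
- by apply/is_derive_Reals; auto_derive.
Qed.

(** The normalized operator is odd in [u], while [quad] is even in its vector; supersolutions
    thereby fall under the results on subsolutions. *)
Lemma visc_super_opp Om h u : visc_super Om h u -> visc_sub Om (fun x => - h x) (fun x => - u x).
Proof.
move=> [cu H]; split.
  move=> x Ox eps eps0; have [d [d0 hd]] := cu x Ox _ eps0; exists d; split=> // y Oy yx.
  have -> : - u y - - u x = - (u y - u x) by ring.
  by rewrite Rabs_Ropp; exact: hd.
move=> x0 phi Dphi D2phi Ox0 /is_C2_opp C2 e0 ge0.
have [||[nz le]|[z [p [p1 le]]]] := H x0 _ _ _ Ox0 C2.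
- by rewrite e0; ring.
- by move=> x /ge0; lra.
- left; split; first by move=> z; apply: nz => i; rewrite z; ring.
  move: le; rewrite /inf_lap quad_opp quad_oppv.
  have -> : vnorm (fun i => - Dphi x0 i) = vnorm (Dphi x0).
    by rewrite /vnorm; congr sqrt; apply: eq_bigr => i _; ring.
  lra.
- right; split; first by move=> i; have := z i; lra.
  by exists p; split=> //; move: le; rewrite quad_opp; lra.
Qed.

(** The constant [u x0] corrected by [C2_localize] is an admissible test function whose gradient and
    Hessian vanish at [x0]. *)
Lemma visc_sub_locally_constant Om h u x0 d : is_open Om -> is_bounded Om -> visc_sub Om h u ->
  Om x0 -> 0 < d -> (forall x, Om x -> vdist x x0 < d -> u x = u x0) -> 0 <= h x0.
Proof.
move=> oOm bOm [cu H] Ox0 d0 cst.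
have [|x Ox /(cst x Ox) ->|W [DW [D2W [C2W [W0 DW0] D2W0 le]]]] :=
  C2_localize Om x0 d (fun x => u x + - u x0) oOm bOm d0.
- by apply: cont_on_plus => //; exact: cont_on_const.
- lra.
have C2 := is_C2_plus _ _ _ _ _ _ _ (is_C2_const Om (u x0)) C2W.
have [||[nz _]|[_ [p [_ ge]]]] := H x0 _ _ _ Ox0 C2.
- by rewrite W0; ring.
- by move=> x /le; lra.
- by case: nz => i; rewrite DW0; ring.
- suff e : quad (fun i j => 0 + D2W x0 i j) p = 0 by rewrite e in ge; lra.
  by rewrite /quad big1 // => i _; rewrite big1 // => j _; rewrite D2W0; ring.
Qed.

(* The cubic Taylor polynomial of the square root lies above it: with [t = s^2] the
   difference is [(s - s0)^4 (s^2 + 4 s s0 + 5 s0^2) / (16 s0^5)]. *)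
Definition sqrt_taylor (s0 t : R) : R :=
  s0 + (t - s0 * s0) / (2 * s0) - (t - s0 * s0) ^ 2 / (8 * s0 ^ 3)
  + (t - s0 * s0) ^ 3 / (16 * s0 ^ 5).

Lemma sqrt_taylor_ge s0 s : 0 < s0 -> 0 <= s -> s <= sqrt_taylor s0 (s * s).
Proof.
move=> s00 s_ge0.
have p5 : 0 < 16 * s0 ^ 5 by have := pow_lt _ 5 s00; lra.
have -> : sqrt_taylor s0 (s * s) =
  s + (s - s0) ^ 2 * (s - s0) ^ 2 * (s * s + 4 * s * s0 + 5 * s0 * s0) / (16 * s0 ^ 5).
  by rewrite /sqrt_taylor; field; lra.
suff : 0 <= (s - s0) ^ 2 * (s - s0) ^ 2 * (s * s + 4 * s * s0 + 5 * s0 * s0) / (16 * s0 ^ 5) by lra.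
apply: Rmult_le_pos; last by apply: Rlt_le; exact: Rinv_0_lt_compat.
apply: Rmult_le_pos; last by nra.
by apply: Rmult_le_pos; exact: pow2_ge_0.
Qed.

(** Where a radial function has nonzero gradient, its normalized infinity Laplacian is the second
    radial derivative, here [-2 beta]. The slope condition makes the radial derivative at [xb]
    positive. *)
Lemma cone_touching Om h u q r alpha beta xb : is_open Om -> is_bounded Om -> visc_sub Om h u ->
  (forall y, vdist y q <= r -> Om y) -> 0 < vdist xb q < r ->
  0 < alpha -> 2 * beta * vdist xb q < alpha ->
  (forall y, vdist y q <= r ->
     u y - (alpha * vdist y q - beta * (vdist y q * vdist y q)) <=
     u xb - (alpha * vdist xb q - beta * (vdist xb q * vdist xb q))) ->
  2 * beta <= h xb.
Proof.
move=> oOm bOm [cu H] Oq; set s0 := vdist xb q => -[s00 s0r] al0 slope mx.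
(* The cone is not C2 at [q]. Replacing the square root of the squared distance by [sqrt_taylor]
   gives a polynomial that lies above the cone, as [alpha > 0], and agrees with it to third order at
   [s0]. *)
pose F t := alpha * sqrt_taylor s0 t - beta * t.
pose F' t := alpha * (1 / (2 * s0) - (t - s0 * s0) / (4 * s0 ^ 3)
  + 3 * (t - s0 * s0) ^ 2 / (16 * s0 ^ 5)) - beta.
pose F'' t := alpha * (- 1 / (4 * s0 ^ 3) + 6 * (t - s0 * s0) / (16 * s0 ^ 5)).
have dF t : derivable_pt_lim F t (F' t).
  apply/is_derive_Reals; rewrite /F /F' /sqrt_taylor; auto_derive => //.
  by field; lra.
have dF' t : derivable_pt_lim F' t (F'' t).
  apply/is_derive_Reals; rewrite /F' /F''; auto_derive => //.
  by field; lra.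
have cF'' t : continuity_pt F'' t.
  apply: derivable_continuous_pt; eexists; apply/is_derive_Reals; rewrite /F''.
  by auto_derive.
have tq : sqdist q xb = s0 * s0 by rewrite /sqdist -vdist_sqr.
have F0 : F (s0 * s0) = alpha * s0 - beta * (s0 * s0).
  by rewrite /F /sqrt_taylor; field; lra.
have F'0 : F' (s0 * s0) = alpha / (2 * s0) - beta by rewrite /F'; field; lra.
have F''0 : F'' (s0 * s0) = - alpha / (4 * s0 ^ 3) by rewrite /F''; field; lra.
have Oxb : Om xb by apply: Oq; rewrite -/s0; lra.
have C2F := is_C2_comp Om F F' F'' _ _ _ (is_C2_sqdist Om q) (fun x _ => dF _)
  (fun x _ => dF' _) (fun x _ => cF'' _).
have [cF _] := is_C2_cont _ _ _ _ C2F.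
have [||x Ox xx|W [DW [D2W [C2W [W0 DW0] D2W0 le]]]] :=
  C2_localize Om xb (r - s0) (fun x => u x + (-1 * F (sqdist q x) + (F (s0 * s0) + - u xb))) oOm bOm.
- lra.
- apply: cont_on_plus => //; apply: cont_on_plus; last exact: cont_on_const.
  by apply: cont_on_mult => //; exact: cont_on_const.
- have xq : vdist x q <= r by have := vdist_triangle xb x q; rewrite -/s0; lra.
  have := mx x xq; rewrite F0 /F /sqdist -vdist_sqr.
  by have := sqrt_taylor_ge s0 (vdist x q) s00 (vdist_ge0 _ _); nra.
have C2 := is_C2_plus _ _ _ _ _ _ _ (is_C2_const Om (u xb - F (s0 * s0)))
  (is_C2_plus _ _ _ _ _ _ _ C2F C2W).
have gpos : 0 < alpha / (2 * s0) - beta.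
  have -> : alpha / (2 * s0) - beta = (alpha - 2 * beta * s0) / (2 * s0) by field; lra.
  by apply: Rdiv_lt_0_compat; lra.
set g := alpha / (2 * s0) - beta in F'0 gpos.
have DE : (fun i => 0 + (F' (sqdist q xb) * (2 * vsub xb q i) + DW xb i)) =
    (fun i => 2 * g * vsub xb q i).
  by apply: functional_extensionality => i; rewrite tq F'0 DW0; ring.
have D2E : (fun i j => 0 + (F' (sqdist q xb) * (if j == i then 2 else 0) +
    2 * vsub xb q i * (F'' (sqdist q xb) * (2 * vsub xb q j)) + D2W xb i j)) =
    (fun i j => g * (if j == i then 2 else 0) +
       2 * vsub xb q i * (F'' (s0 * s0) * (2 * vsub xb q j))).
  apply: functional_extensionality => i; apply: functional_extensionality => j.
  by rewrite tq F'0 D2W0; ring.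
have [||[_ ge]|[z _]] := H xb _ _ _ Oxb C2.
- by rewrite tq W0; ring.
- by move=> x /le; lra.
- move: ge; rewrite /inf_lap DE D2E quad_rank_one dot_scall !dot_scalr.
  rewrite -vdist_sqr -/s0 vnorm_scal -/(vdist xb q) -/s0 Rabs_pos_eq; last lra.
  rewrite F''0 => ge.
  (* The share of [alpha] in [g] cancels against [F''], leaving the radial second derivative times
     the squared gradient. *)
  have E : 2 * g * (2 * g * (2 * g * (s0 * s0))) +
     4 * (- alpha / (4 * s0 ^ 3)) * (2 * g * (s0 * s0) * (2 * g * (s0 * s0))) =
     - (2 * beta) * (2 * g * s0) ^ 2 by rewrite /g; field; lra.
  have pos : 0 < (2 * g * s0) ^ 2 by apply: pow_lt; apply: Rmult_lt_0_compat; lra.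
  apply: (Rmult_le_reg_r ((2 * g * s0) ^ 2)) => //; lra.
- suff : s0 = 0 by lra.
  rewrite /s0 /vdist /vnorm; suff -> : dot (vsub xb q) (vsub xb q) = 0 by exact: sqrt_0.
  rewrite /dot big1 // => i _; have := z i; rewrite (equal_f DE i) => e.
  have -> : vsub xb q i = 0 by apply: (Rmult_eq_reg_l (2 * g)); lra.
  ring.
Qed.

(** If the bound fails at [p], bend the cone to [Q], which adds [k (r t - t^2)] at distance [t] and
    so changes nothing at [q] and on the sphere. The maximum of [u - Q] then lies strictly between
    the two, and [cone_touching] gives [a + 2 k <= h <= a]. *)
Lemma cone_comparison Om h u q r a S : is_open Om -> is_bounded Om -> visc_sub Om h u ->
  0 < r -> (forall y, vdist y q <= r -> Om y /\ h y <= a) -> 0 < S -> a * r < S ->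
  (forall z, vdist z q = r -> u z - u q <= S * r - a / 2 * (r * r)) ->
  forall p, vdist p q <= r -> u p - u q <= S * vdist p q - a / 2 * (vdist p q * vdist p q).
Proof.
move=> oOm bOm vu r0 ball S0 Sa sph p pr; apply: Rnot_lt_le; set s := vdist p q => lt.
set eta := u p - u q - (S * s - a / 2 * (s * s)); have eta0 : 0 < eta by rewrite /eta; lra.
(* [sg] is the least slope of the cone on [[0, r]]. The bound [k r <= sg / 2] keeps the bent cone
   increasing, and [k r^2 <= eta] keeps the value at [p] above the one at [q]. *)
pose sg := Rmin S (S - a * r); have sg0 : 0 < sg by apply: Rmin_pos; lra.
have sg1 : sg <= S by exact: Rmin_l.
have sg2 : sg <= S - a * r by exact: Rmin_r.
pose k := Rmin (sg / (2 * r)) (eta / (r * r)).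
have rr : 0 < r * r by nra.
have k0 : 0 < k by apply: Rmin_pos; apply: Rdiv_lt_0_compat; lra.
have k1 : k * r <= sg / 2.
  have -> : sg / 2 = sg / (2 * r) * r by field; lra.
  by apply: Rmult_le_compat_r; [lra | exact: Rmin_l].
have k2 : k * (r * r) <= eta.
  have -> : eta = eta / (r * r) * (r * r) by field; lra.
  by apply: Rmult_le_compat_r; [lra | exact: Rmin_r].
pose Q t := (S + k * r) * t - (a / 2 + k) * (t * t).
have [cu _] := vu.
have cw : cont_on (fun x => vdist x q <= r) (fun x => u x + -1 * Q (vdist x q)).
  apply: cont_on_plus; first by apply: cont_on_sub cu => x /ball [].
  apply: cont_on_mult; first exact: cont_on_const.
  apply: cont_on_comp (cont_on_vdist _ q) => x _; apply: derivable_continuous_pt.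
  by eexists; apply/is_derive_Reals; rewrite /Q; auto_derive.
have [xb [xr mx]] := ball_max q r _ ltac:(lra) cw.
have s_ge0 := vdist_ge0 p q; rewrite -/s in s_ge0.
have wp : u q < u p - Q s.
  have : k * (r * s - s * s) < k * (r * r) by apply: Rmult_lt_compat_l => //; nra.
  by rewrite /Q; rewrite /eta in k2; nra.
have wxb : u q < u xb - Q (vdist xb q) by have := mx p pr; rewrite -/s; lra.
have Qr : Q r = S * r - a / 2 * (r * r) by rewrite /Q; field.
have sb0 := vdist_ge0 xb q.
have sb1 : vdist xb q <> 0.
  by move=> e; move: wxb; rewrite e (vdist_eq0 _ _ e) /Q; lra.
have sb2 : vdist xb q <> r.
  by move=> e; move: wxb; rewrite e Qr; have := sph _ e; lra.
have sbs : 0 < vdist xb q < r by lra.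
have [_ hb] := ball xb xr.
have := cone_touching Om h u q r (S + k * r) (a / 2 + k) xb oOm bOm vu.
move=> /(_ (fun y yq => proj1 (ball y yq)) sbs).
set t := vdist xb q in sbs *.
have kt : k * t <= k * r by apply: Rmult_le_compat_l; lra.
have at' : a * t <= Rmax 0 (a * r).
  case: (Rle_dec 0 a) => ha.
    by apply: Rle_trans (Rmax_r _ _); apply: Rmult_le_compat_l; lra.
  by apply: Rle_trans (Rmax_l _ _); nra.
have at2 : a * t <= S - sg.
  by apply: Rle_trans at' _; apply: Rmax_lub; lra.
have kr : 0 < k * r by apply: Rmult_lt_0_compat.
move=> /(_ ltac:(lra) ltac:(lra)) touch.
suff : 2 * (a / 2 + k) <= h xb by lra.
by apply: touch => y yq; have := mx y yq; rewrite /Q /t; lra.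
Qed.

End ConeComparison.

(** * Slope estimates derived from cone comparison *)

Section SlopeEstimates.
Context {n : nat}.
Implicit Types (x y z e p q c : vec n) (u : vec n -> R).

(** All that is retained of the equation from here on; for supersolutions it is applied to [- u] and
    [- b]. [R0] is a radius here, shadowing the real zero. *)
Definition cone_cmp (x0 : vec n) (R0 : R) u (a : R) : Prop := forall q r S,
  0 < r -> vdist q x0 + r < R0 -> 0 < S -> a * r < S ->
  (forall z, vdist z q = r -> u z - u q <= S * r - a / 2 * (r * r)) ->
  forall p, vdist p q <= r -> u p - u q <= S * vdist p q - a / 2 * (vdist p q * vdist p q).

Lemma cone_cmp_lipschitz x0 R0 u a : 0 < R0 -> cone_cmp x0 R0 u a ->
  (forall y, vdist y x0 < R0 -> Rabs (u y - u x0) < 1) ->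
  exists Lam, 0 < Lam /\ forall q p, vdist q x0 < R0 / 2 -> vdist p q <= R0 / 4 ->
    u p - u q <= Lam * vdist p q.
Proof.
(* On spheres of radius [R0 / 4] the term [8 / R0] yields 2, which bounds the oscillation of [u];
   [Rabs a * R0] absorbs the quadratic term. *)
move=> R00 cc bu; pose S := 8 / R0 + Rabs a * R0.
have a0 := Rabs_pos a; have a1 := Rle_abs a; have a2 := Rle_abs (- a); rewrite Rabs_Ropp in a2.
have aR : 0 <= Rabs a * R0 by apply: Rmult_le_pos; lra.
have aR1 : a * R0 <= Rabs a * R0 by apply: Rmult_le_compat_r; lra.
have R8 : 0 < 8 / R0 by apply: Rdiv_lt_0_compat; lra.
exists (S + Rabs a * R0); split=> [|q p qx pq]; first by rewrite /S; lra.
apply: Rle_trans (cc q (R0 / 4) S _ _ _ _ _ p pq) _; try lra; try by rewrite /S; lra.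
- move=> z zq; have h1 := bu z; have h2 := bu q.
  have zx : vdist z x0 < R0 by have := vdist_triangle q z x0; lra.
  have d1 : u z - u q <= 2.
    have := h1 zx; have := h2 ltac:(lra).
    have := Rle_abs (u z - u x0); have := Rle_abs (- (u q - u x0)); rewrite Rabs_Ropp; lra.
  have -> : S * (R0 / 4) = 2 + Rabs a * R0 * R0 / 4 by rewrite /S; field; lra.
  have : a * R0 * R0 <= Rabs a * R0 * R0 by apply: Rmult_le_compat_r; lra.
  have : 0 <= Rabs a * R0 * R0 by apply: Rmult_le_pos; lra.
  lra.
- have s0 := vdist_ge0 p q; set s := vdist p q in pq s0 *.
  have : - a * s <= Rabs a * R0.
    apply: Rle_trans (_ : Rabs a * s <= _); first by apply: Rmult_le_compat_r; lra.
    by apply: Rmult_le_compat_l; lra.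
  by nra.
Qed.

(** Without such a [z], [u] lies on the sphere of radius [2 eps] below the cone of slope [S], chosen
    to take there the value [2 (u p - u x) - (a + k) eps^2]. At [p] that cone is [k eps^2 / 2] below
    [u p - u x], against comparison. *)
Lemma cone_cmp_extend x0 R0 u a x p eps k : cone_cmp x0 R0 u a -> 0 < eps -> 0 < k ->
  vdist x x0 + 2 * eps < R0 -> vdist p x = eps ->
  0 < u p - u x + (a - k) / 2 * (eps * eps) ->
  2 * a * (eps * eps) < u p - u x + (a - k) / 2 * (eps * eps) ->
  exists z, vdist z x = 2 * eps /\ u z - 2 * u p + u x >= - (a + k) * (eps * eps).
Proof.
move=> cc eps0 k0 dom px S0 Sa; apply: NNPP => nex.
have ee : 0 < eps * eps by nra.
pose S := (u p - u x + (a - k) / 2 * (eps * eps)) / eps.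
have SE : S * eps = u p - u x + (a - k) / 2 * (eps * eps) by rewrite /S; field; lra.
have := cc x (2 * eps) S ltac:(lra) dom.
have Sp : 0 < S by apply: Rdiv_lt_0_compat.
have Sa' : a * (2 * eps) < S.
  by apply: (Rmult_lt_reg_r eps) => //; rewrite SE; lra.
move=> /(_ Sp Sa') h; have := h _ p; rewrite px.
have -> : S * (2 * eps) = 2 * (S * eps) by ring.
rewrite SE => {}h; suff : u p - u x <= u p - u x + (a - k) / 2 * (eps * eps) - a / 2 * (eps * eps).
  have : 0 < k * (eps * eps) by apply: Rmult_lt_0_compat.
  lra.
apply: h; last lra.
move=> z zx; apply: Rnot_lt_le => lt; apply: nex; exists z; split=> //; lra.
Qed.

Lemma vdist_segment x0 p q t rho : 0 <= t <= 1 -> vdist p x0 < rho -> vdist q x0 < rho ->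
  vdist (vadd q t (vsub p q)) x0 < rho.
Proof.
move=> t01 hp hq.
have := vnorm_triangle (fun i => (1 - t) * vsub q x0 i) (vsub p x0) t.
rewrite vnorm_scal !Rabs_pos_eq; try lra.
have -> : vadd (fun i => (1 - t) * vsub q x0 i) t (vsub p x0) = vsub (vadd q t (vsub p q)) x0.
  by apply: functional_extensionality => i; rewrite /vadd /vsub; ring.
rewrite -/(vdist q x0) -/(vdist p x0) -/(vdist _ x0) => h.
have h1 : (1 - t) * vdist q x0 <= (1 - t) * Rmax (vdist p x0) (vdist q x0).
  by apply: Rmult_le_compat_l; [lra | exact: Rmax_r].
have h2 : t * vdist p x0 <= t * Rmax (vdist p x0) (vdist q x0).
  by apply: Rmult_le_compat_l; [lra | exact: Rmax_l].
by have := Rmax_lub_lt _ _ _ hp hq; lra.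
Qed.

(** Cut the segment from [q] to [p] into [N + 1] equal pieces: their increments telescope, so one is
    at least the average. [c] is the midpoint of that piece and [e] half of it. *)
Lemma steep_piece u p q x0 rho (N : nat) : vdist p x0 < rho -> vdist q x0 < rho ->
  exists c e, [/\ vdist c x0 < rho, vnorm e = vdist p q / (2 * INR N.+1) &
    (u p - u q) / INR N.+1 <= u (vadd c 1 e) - u (vadd c (-1) e)].
Proof.
move=> hp hq; apply: NNPP => nex.
have N0 : 0 < INR N.+1 by apply: lt_0_INR; lia.
have iN : 0 < / INR N.+1 by exact: Rinv_0_lt_compat.
pose X (j : nat) := vadd q (INR j / INR N.+1) (vsub p q).
have step j : (j < N.+1)%N -> u (X j.+1) - u (X j) < (u p - u q) / INR N.+1.
  move=> jN; apply: Rnot_le_lt => le; apply: nex.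
  exists (vadd q ((2 * INR j + 1) / (2 * INR N.+1)) (vsub p q)),
    (fun i => / (2 * INR N.+1) * vsub p q i).
  have jN' : INR j + 1 <= INR N.+1 by rewrite -S_INR; apply: le_INR; apply/leP.
  have j0 := pos_INR j.
  split.
  - apply: vdist_segment => //; split; first by apply: Rdiv_le_0_compat; lra.
    by apply: (Rmult_le_reg_r (2 * INR N.+1)); first lra;
      rewrite /Rdiv Rmult_assoc Rinv_l; lra.
  - rewrite vnorm_scal Rabs_pos_eq; last by apply: Rlt_le; apply: Rinv_0_lt_compat; lra.
    by rewrite /vdist; field; lra.
  - have <- : X j.+1 = vadd (vadd q ((2 * INR j + 1) / (2 * INR N.+1)) (vsub p q)) 1
        (fun i => / (2 * INR N.+1) * vsub p q i).
      by apply: functional_extensionality => i; rewrite /X /vadd (S_INR j); field; lra.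
    have <- : X j = vadd (vadd q ((2 * INR j + 1) / (2 * INR N.+1)) (vsub p q)) (-1)
        (fun i => / (2 * INR N.+1) * vsub p q i); last by [].
    by apply: functional_extensionality => i; rewrite /X /vadd; field; lra.
have X0 : X 0%N = q.
  by apply: functional_extensionality => i; rewrite /X /vadd -[INR 0]/0; field; lra.
have XN : X N.+1 = p.
  by apply: functional_extensionality => i; rewrite /X /vadd /vsub; field; lra.
have acc j : (j < N.+1)%N -> u (X j.+1) - u q < INR j.+1 * ((u p - u q) / INR N.+1).
  elim: j => [|j IH] jN; first by have := step _ jN; rewrite X0 Rmult_1_l.
  have h1 := IH (ltnW jN); have h2 := step _ jN; rewrite (S_INR j.+1) Rmult_plus_distr_r.
  lra.
have := acc N (leqnn _); rewrite XN.
have -> : INR N.+1 * ((u p - u q) / INR N.+1) = u p - u q by field; lra.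
lra.
Qed.

Lemma near_maximizer (T : vec n -> vec n -> Prop) (Th : vec n -> vec n -> R) M k x1 e1 :
  0 < k -> T x1 e1 -> (forall x e, T x e -> Th x e <= M) ->
  exists x e, T x e /\ forall x' e', T x' e' -> Th x' e' <= Th x e + k.
Proof.
move=> k0 T1 bd.
have [s [ub lub]] : { s | is_lub (fun t => exists x e, T x e /\ t = Th x e) s }.
  apply: completeness; first by exists M => t [x [e [Te ->]]]; exact: bd.
  by exists (Th x1 e1), x1, e1.
apply: NNPP => nex; suff : s <= s - k by lra.
apply: lub => t [x [e [Te ->]]]; apply: Rnot_lt_le => lt; apply: nex.
exists x, e; split=> // x' e' T'; have : Th x' e' <= s by apply: ub; exists x', e'.
lra.
Qed.

End SlopeEstimates.

(** * Local slopes and extension of an almost steepest segment *)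

Section Uniqueness.
Context {n : nat}.
Implicit Types (x y z e p q c : vec n) (u : vec n -> R).

Lemma vadd_vadd x s t e : vadd (vadd x s e) t e = vadd x (s + t) e.
Proof. by apply: functional_extensionality => i; rewrite /vadd; ring. Qed.

Lemma vadd_to x z t : t <> 0 -> vadd x t (fun i => / t * vsub z x i) = z.
Proof. by move=> t0; apply: functional_extensionality => i; rewrite /vadd /vsub; field. Qed.

(** A point at distance [4 eps] from [q] is reached by two consecutive segments of length [2 eps],
    centred at [q + e] and [q + 3 e], within [5 eps] of [x]. This bounds [u] on the sphere, and cone
    comparison carries the bound inside. *)
Lemma local_slope_bound x0 R0 u a A x eps L C1 : cone_cmp x0 R0 u a -> Rabs a <= A ->
  0 < eps -> 0 < L -> 0 <= C1 -> vdist x x0 + 6 * eps < R0 ->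
  (forall x' e', vnorm e' = eps -> vdist x' x <= 5 * eps ->
     u (vadd x' 1 e') - u (vadd x' (-1) e') <= 2 * eps * L + C1 * (eps * eps)) ->
  forall q p, vdist q x <= 2 * eps -> vdist p q <= 4 * eps ->
    u p - u q <= vdist p q * (L + (C1 / 2 + 6 * A) * eps).
Proof.
move=> cc aA eps0 L0 C10 dom near q p qx pq.
have a1 := Rle_abs a; have a2 := Rle_abs (- a); rewrite Rabs_Ropp in a2.
have A0 : 0 <= A by have := Rabs_pos a; lra.
have ee : 0 < eps * eps by nra.
(* Of the [6 * A] in the conclusion, [4 * A] serves the sphere and the condition on [S], and [2 * A]
   the quadratic term inside the ball. *)
pose S := L + (C1 / 2 + 4 * A) * eps.
have Ae : 0 <= A * eps by nra.
have Ce : 0 <= C1 * eps by nra.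
have ae : a * eps <= A * eps by apply: Rmult_le_compat_r; lra.
have qx0 : vdist q x0 + 4 * eps < R0 by have := vdist_triangle x q x0; lra.
apply: Rle_trans (cc q (4 * eps) S _ qx0 _ _ _ p pq) _; try lra; try by rewrite /S; lra.
- move=> z zq; set e := (fun i => / 4 * vsub z q i) : vec n.
  have e1 : vnorm e = eps by rewrite /e vnorm_scal -/(vdist z q) zq Rabs_pos_eq; lra.
  have zE : z = vadd q 4 e by rewrite vadd_to //; lra.
  have cdist t : 0 <= t <= 3 -> vdist (vadd q t e) x <= 5 * eps.
    move=> t3; have := vdist_triangle q (vadd q t e) x; rewrite vdist_vadd e1 Rabs_pos_eq; last lra.
    have : t * eps <= 3 * eps by apply: Rmult_le_compat_r; lra.
    lra.
  have := near (vadd q 3 e) e e1 (cdist 3 ltac:(lra)).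
  have := near (vadd q 1 e) e e1 (cdist 1 ltac:(lra)).
  rewrite !vadd_vadd.
  have -> : 3 + 1 = 4 by ring.
  have -> : 3 + -1 = 1 + 1 by ring.
  have -> : vadd q (1 + -1) e = q by apply: functional_extensionality => i; rewrite /vadd; ring.
  rewrite -zE => h1 h2.
  have -> : S * (4 * eps) = 4 * eps * L + 2 * (C1 * (eps * eps)) + 16 * (A * (eps * eps)).
    by rewrite /S; field.
  have : a * (eps * eps) <= A * (eps * eps) by apply: Rmult_le_compat_r; lra.
  have : 0 <= A * (eps * eps) by apply: Rmult_le_pos; lra.
  lra.
- have s0 := vdist_ge0 p q; set s := vdist p q in pq s0 *.
  have : - a * s <= A * (4 * eps).
    apply: Rle_trans (_ : A * s <= _); first by apply: Rmult_le_compat_r; lra.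
    by apply: Rmult_le_compat_l; lra.
  move=> h; have : s * (- a * s) <= s * (A * (4 * eps)) by apply: Rmult_le_compat_l.
  by rewrite /S; lra.
Qed.

(* The extensions [zp] and [zm] of the segment through [x] realize almost the maximal
   slope [L], so by [local_slope_bound] they are almost [4 eps] apart; the parallelogram
   law then makes [x] almost their midpoint. *)
Lemma almost_opposite_extensions x0 R0 u a b A x e eps L C1 k :
  cone_cmp x0 R0 u a -> cone_cmp x0 R0 (fun y => - u y) (- b) ->
  Rabs a <= A -> Rabs b <= A -> 0 < eps -> 0 < L -> 0 <= C1 -> 0 < k -> 2 * k <= b - a ->
  vdist x x0 + 6 * eps < R0 -> vnorm e = eps ->
  u (vadd x 1 e) - u (vadd x (-1) e) = 2 * eps * L ->
  (forall x' e', vnorm e' = eps -> vdist x' x <= 5 * eps ->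
     u (vadd x' 1 e') - u (vadd x' (-1) e') <= 2 * eps * L + C1 * (eps * eps)) ->
  eps * ((C1 / 2 + 6 * A) + 3 * A + k) < L ->
  exists zp zm, [/\ vdist zp x = 2 * eps, vdist zm x = 2 * eps,
    u zp - u zm >= 4 * eps * L + (b - a - 2 * k) * (eps * eps) &
    L * (vnorm (vadd (vsub zp x) 1 (vsub zm x)) * vnorm (vadd (vsub zp x) 1 (vsub zm x)))
      <= 32 * (C1 / 2 + 6 * A) * (eps * eps * eps)].
Proof.
move=> ca cb aA bA eps0 L0 C10 k0 kab dom e1 Le near small.
have slope := local_slope_bound x0 R0 u a A x eps L C1 ca aA eps0 L0 C10 dom near.
have A0 : 0 <= A by have := Rabs_pos a; lra.
set C3 := C1 / 2 + 6 * A in small slope *.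
have C30 : 0 <= C3 by rewrite /C3; lra.
have ee : 0 < eps * eps by nra.
have small' : eps * eps * (C3 + 3 * A + k) < eps * L by nra.
have a1 := Rle_abs a; have a2 := Rle_abs (- a); rewrite Rabs_Ropp in a2.
have b1 := Rle_abs b; have b2 := Rle_abs (- b); rewrite Rabs_Ropp in b2.
have ae : - A * (eps * eps) <= a * (eps * eps) <= A * (eps * eps).
  by split; apply: Rmult_le_compat_r; lra.
have be : - A * (eps * eps) <= b * (eps * eps) <= A * (eps * eps).
  by split; apply: Rmult_le_compat_r; lra.
have Ae : 0 <= A * (eps * eps) by apply: Rmult_le_pos; lra.
have ke : 0 < k * (eps * eps) by apply: Rmult_lt_0_compat.
have Ce : 0 <= C3 * (eps * eps) by apply: Rmult_le_pos; lra.
have dp : vdist (vadd x 1 e) x = eps by rewrite vdist_vadd e1 Rabs_pos_eq; lra.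
have dm : vdist (vadd x (-1) e) x = eps by rewrite vdist_vadd e1 Rabs_left1; lra.
(* Neither half of the increment [2 eps L] exceeds [eps (L + C3 eps)], so each is at least
   [eps (L - C3 eps)]; with [small'] this meets the conditions for both extensions. *)
have sp := slope x (vadd x 1 e) ltac:(rewrite vdist_refl; lra) ltac:(lra).
have sm := slope (vadd x (-1) e) x ltac:(lra) ltac:(rewrite vdist_sym; lra).
rewrite dp in sp; rewrite vdist_sym dm in sm.
have [||zp [zpx zpu]] := cone_cmp_extend x0 R0 u a x (vadd x 1 e) eps k ca eps0 k0 ltac:(lra) dp.
- lra.
- lra.
have [||zm [zmx zmu]] := cone_cmp_extend x0 R0 _ (- b) x (vadd x (-1) e) eps k cb eps0 k0 ltac:(lra) dm.
- lra.
- lra.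
(* Adding the two extension inequalities cancels [u x]. *)
have gap : u zp - u zm >= 4 * eps * L + (b - a - 2 * k) * (eps * eps) by lra.
exists zp, zm; split=> //.
have Dle : vdist zp zm <= 4 * eps by have := vdist_triangle x zp zm; rewrite (vdist_sym x zm); lra.
have := slope zm zp ltac:(lra) Dle.
have D0 := vdist_ge0 zp zm; set D := vdist zp zm in Dle D0 * => up.
have kb : 0 <= (b - a - 2 * k) * (eps * eps) by apply: Rmult_le_pos; lra.
have DC : D * (C3 * eps) <= 4 * eps * (C3 * eps).
  by apply: Rmult_le_compat_r => //; apply: Rmult_le_pos; lra.
(* Since [2 k <= b - a], the gap is at least [4 eps L]; compare with the slope bound between [zm]
   and [zp]. *)
have LD : L * (4 * eps - D) <= 4 * (C3 * (eps * eps)) by lra.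
have -> : vnorm (vadd (vsub zp x) 1 (vsub zm x)) * vnorm (vadd (vsub zp x) 1 (vsub zm x)) =
    (4 * eps - D) * (4 * eps + D).
  have ->: (4 * eps - D) * (4 * eps + D) =
    2 * (2 * eps * (2 * eps)) + 2 * (2 * eps * (2 * eps)) - D * D by ring.
  rewrite -{1 2}zpx -zmx /D !vdist_sqr vnorm_sqr.
  rewrite !(dot_vaddl, dot_vaddr, dot_vsubl, dot_vsubr).
  rewrite (dotC x zp) (dotC x zm) (dotC zm zp); ring.
have : L * (4 * eps - D) * (4 * eps + D) <= 4 * (C3 * (eps * eps)) * (8 * eps).
  by apply: Rmult_le_compat => //; try lra; apply: Rmult_le_pos; lra.
lra.
Qed.

End Uniqueness.

(** * Local constancy under a strict gap, and uniqueness of the right-hand side *)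

Section LocallyConstant.
Context {n : nat}.
Implicit Types (x y z e p q c : vec n) (u : vec n -> R).

Lemma strict_gap_locally_constant x0 R0 u a b : 0 < R0 -> a < b ->
  cone_cmp x0 R0 u a -> cone_cmp x0 R0 (fun y => - u y) (- b) ->
  (forall y, vdist y x0 < R0 -> Rabs (u y - u x0) < 1) ->
  forall p q, vdist p x0 < R0 / 8 -> vdist q x0 < R0 / 8 -> u p <= u q.
Proof.
move=> R00 ab ca cb bu p q px qx; apply: Rnot_lt_le => lt.
have [Lam [Lam0 lip]] := cone_cmp_lipschitz x0 R0 u a R00 ca bu.
pose rho := R0 / 16; have rho0 : 0 < rho by rewrite /rho; lra.
pose A := Rabs a + Rabs b.
have aA : Rabs a <= A by rewrite /A; have := Rabs_pos b; lra.
have bA : Rabs b <= A by rewrite /A; have := Rabs_pos a; lra.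
have A0 : 0 <= A by have := Rabs_pos a; lra.
(* The slack [k eps^2] is spent four times, in the two extensions and in the two comparisons with
   the near maximizer; half of [b - a] survives. *)
pose k := (b - a) / 8; have k0 : 0 < k by rewrite /k; lra.
(* At distance [rho] from [c] the penalty [eps K rho^2] equals the largest possible increment
   [2 eps Lam], which confines [x] to that ball whatever [eps] is. *)
pose K := 2 * Lam / (rho * rho).
have rr : 0 < rho * rho by nra.
have K0 : 0 < K by apply: Rdiv_lt_0_compat; lra.
have KE : K * (rho * rho) = 2 * Lam by rewrite /K; field; lra.
pose d := vdist p q.
have d0 : 0 < d.
  have := vdist_ge0 p q; rewrite -/d => -[//|e].
  by move: lt; rewrite (vdist_eq0 p q); [lra | rewrite -/d].
pose L0 := (u p - u q) / d; have L00 : 0 < L0 by apply: Rdiv_lt_0_compat; lra.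
have Krho : 0 < K * rho by nra.
(* Moving the centre by [5 eps] changes [|x - c|^2] by at most
   [10 rho eps + 25 eps^2 <= 35 rho eps]. *)
pose C1 := 35 * (K * rho) + k; have C10 : 0 <= C1 by rewrite /C1; lra.
pose C3 := C1 / 2 + 6 * A; have C30 : 0 <= C3 by rewrite /C3; lra.
(* [tau] is the weight in the later AM-GM step, set so that the term linear in [eps] costs only
   [(b - a) / 8]; [Gam] comes from [L >= L0 / 2], and [Z] collects the terms of higher order. *)
pose tau := (b - a) / (8 * (K * rho)); have tau0 : 0 < tau by apply: Rdiv_lt_0_compat; lra.
have tauE : K * rho * tau = (b - a) / 8 by rewrite /tau; field; split; lra.
pose Gam := 64 * C3 / L0; have Gam0 : 0 <= Gam by apply: Rdiv_le_0_compat; lra.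
pose Z := K * rho * (Gam / (4 * tau)) + 2 * K.
have Gt : 0 <= Gam / (4 * tau) by apply: Rdiv_le_0_compat; lra.
have Z0 : 0 <= Z by have := Rmult_le_pos _ _ (Rlt_le _ _ Krho) Gt; rewrite /Z; lra.
(* Each summand of [M] times [eps] will be below [m], so the single condition [eps * M < m] contains
   all the smallness required. *)
pose M := 1 + k + (C3 + 3 * A + k) + Z.
pose m := Rmin (rho / 8) (Rmin (L0 / 2) ((b - a) / 4)).
have m0 : 0 < m by do 2?apply: Rmin_pos; lra.
have m1 : m <= rho / 8 by exact: Rmin_l.
have m2 : m <= L0 / 2 by apply: Rle_trans (Rmin_r _ _) (Rmin_l _ _).
have m3 : m <= (b - a) / 4 by apply: Rle_trans (Rmin_r _ _) (Rmin_r _ _).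
have M0 : 0 < M by rewrite /M; lra.
have [N hN] := INR_unbounded (d * M / m).
have N0 : 0 < INR N.+1 by apply: lt_0_INR; lia.
have [c [ec [cx ece cu]]] := steep_piece u p q x0 (R0 / 8) N px qx.
rewrite -/d in ece; set eps := d / (2 * INR N.+1) in ece.
have eps0 : 0 < eps by apply: Rdiv_lt_0_compat; lra.
have epsM : eps * M < m.
  have h1 : d * M < m * INR N.+1.
    have -> : d * M = d * M / m * m by field; lra.
    by rewrite Rmult_comm; apply: Rmult_lt_compat_l => //; rewrite S_INR; lra.
  have -> : eps * M = d * M / INR N.+1 / 2 by rewrite /eps; field; lra.
  have : d * M / INR N.+1 < m.
    apply: (Rmult_lt_reg_r (INR N.+1)) => //.
    by have -> : d * M / INR N.+1 * INR N.+1 = d * M by field; lra.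
  have : 0 < d * M / INR N.+1 by apply: Rdiv_lt_0_compat => //; nra.
  lra.
have s1 : 0 <= eps * k by nra.
have s2 : 0 <= eps * (C3 + 3 * A + k) by apply: Rmult_le_pos; lra.
have s3 : 0 <= eps * Z by nra.
have epsME : eps * M = eps + eps * k + eps * (C3 + 3 * A + k) + eps * Z by rewrite /M; ring.
have cL : 2 * eps * L0 <= u (vadd c 1 ec) - u (vadd c (-1) ec).
  by apply: Rle_trans cu; apply: Req_le; rewrite /eps /L0; field; lra.
clear cu hN; clearbody eps.
have ee : 0 < eps * eps by nra.
pose T x e := vdist x x0 <= R0 / 4 /\ vnorm e = eps.
pose Th x e := u (vadd x 1 e) - u (vadd x (-1) e) - eps * K * sqdist c x.
have sq0 x : 0 <= sqdist c x by exact: dot_ge0.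
have incr x e : T x e -> u (vadd x 1 e) - u (vadd x (-1) e) <= 2 * eps * Lam.
  move=> [xx0 e1].
  have dm : vdist (vadd x (-1) e) x = eps by rewrite vdist_vadd e1 Rabs_left1; lra.
  have dd : vdist (vadd x 1 e) (vadd x (-1) e) = 2 * eps.
    have -> : vadd x 1 e = vadd (vadd x (-1) e) 2 e by rewrite vadd_vadd; congr vadd; ring.
    by rewrite vdist_vadd e1 Rabs_pos_eq; lra.
  have := lip (vadd x (-1) e) (vadd x 1 e); rewrite dd => h.
  have := vdist_triangle x (vadd x (-1) e) x0; rewrite dm /rho in m1 * => tri.
  by have := h ltac:(lra) ltac:(lra); lra.
have Tc : T c ec by split=> //; lra.
have eK : 0 < eps * K by nra.
have Thb x e : T x e -> Th x e <= 2 * eps * Lam.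
  by move=> /incr h; rewrite /Th; have := Rmult_le_pos _ _ (Rlt_le _ _ eK) (sq0 x); lra.
have kee : 0 < k * (eps * eps) by nra.
have [x [e [[xx0 e1] mx]]] := near_maximizer T Th _ _ c ec kee Tc Thb.
have Thc : Th c ec >= 2 * eps * L0.
  by rewrite /Th /sqdist -vdist_sqr vdist_refl; lra.
pose L := (u (vadd x 1 e) - u (vadd x (-1) e)) / (2 * eps).
have LE : u (vadd x 1 e) - u (vadd x (-1) e) = 2 * eps * L by rewrite /L; field; lra.
have Th_pos : eps * L0 <= Th x e.
  have : eps * (eps * k) <= eps * L0 by apply: Rmult_le_compat_l; lra.
  by have := mx c ec Tc; lra.
have L_ge : L0 / 2 <= L.
  have := Rmult_le_pos _ _ (Rlt_le _ _ eK) (sq0 x); rewrite /Th LE in Th_pos => h.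
  by apply: (Rmult_le_reg_l (2 * eps)); lra.
have xc : vdist x c <= rho.
  have h := incr x e (conj xx0 e1).
  have h1 : eps * (K * sqdist c x) <= eps * (K * (rho * rho)).
    have : 0 < eps * L0 by nra.
    by move: Th_pos; rewrite /Th KE; lra.
  have h2 : sqdist c x <= rho * rho.
    by apply: (Rmult_le_reg_l K) => //; apply: (Rmult_le_reg_l eps).
  by have := vdist_ge0 x c; rewrite /sqdist -vdist_sqr in h2; nra.
have xx0' : vdist x x0 <= 3 * rho by have := vdist_triangle c x x0; rewrite /rho in xc *; lra.
have eps_rho : 8 * eps < rho by lra.
have near x' e' : vnorm e' = eps -> vdist x' x <= 5 * eps ->
   u (vadd x' 1 e') - u (vadd x' (-1) e') <=
     2 * eps * L + eps * K * (sqdist c x' - sqdist c x) + k * (eps * eps).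
  move=> e'1 x'x; have T' : T x' e'.
    by split=> //; have := vdist_triangle x x' x0; rewrite /rho in xx0' eps_rho; lra.
  by have := mx x' e' T'; rewrite /Th LE; lra.
have near' x' e' : vnorm e' = eps -> vdist x' x <= 5 * eps ->
   u (vadd x' 1 e') - u (vadd x' (-1) e') <= 2 * eps * L + C1 * (eps * eps).
  move=> e'1 x'x; have := near x' e' e'1 x'x.
  have dq : sqdist c x' - sqdist c x <= 35 * rho * eps.
    rewrite /sqdist -!vdist_sqr.
    have t1 := vdist_triangle x x' c; have t0 := vdist_ge0 x' c; have t2 := vdist_ge0 x c.
    have : vdist x' c * vdist x' c <= (vdist x c + 5 * eps) * (vdist x c + 5 * eps).
      by apply: Rmult_le_compat; lra.
    have : vdist x c * eps <= rho * eps by apply: Rmult_le_compat_r; lra.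
    have : eps * eps <= rho * eps by apply: Rmult_le_compat_r; lra.
    lra.
  have : eps * K * (sqdist c x' - sqdist c x) <= eps * K * (35 * rho * eps).
    by apply: Rmult_le_compat_l; lra.
  by rewrite /C1; lra.
have dom : vdist x x0 + 6 * eps < R0 by rewrite /rho in xx0' eps_rho; lra.
have Lpos : 0 < L by lra.
have [zp [zm [zpx zmx gap gsq]]] := almost_opposite_extensions x0 R0 u a b A x e eps L C1 k
  ca cb aA bA eps0 Lpos C10 k0 ltac:(rewrite /k; lra) dom e1 LE near' ltac:(rewrite -/C3; lra).
set G := vadd (vsub zp x) 1 (vsub zm x) in gsq; rewrite -/C3 in gsq.
have half z : vdist z x = 2 * eps -> vnorm (fun i => / 2 * vsub z x i) = eps.
  by move=> zx; rewrite vnorm_scal -/(vdist z x) zx Rabs_pos_eq; lra.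
(* The pairs centred at [x + ep] and [x - em] run from [x] to [zp] and from [zm] to [x]; their
   increments add up to [u zp - u zm]. *)
pose ep : vec n := fun i => / 2 * vsub zp x i; pose em : vec n := fun i => / 2 * vsub x zm i.
have ep1 : vnorm ep = eps by exact: half.
have em1 : vnorm em = eps.
  by rewrite /em vnorm_scal -/(vdist x zm) vdist_sym zmx Rabs_pos_eq; lra.
have := near (vadd x 1 ep) ep ep1; rewrite vdist_vadd ep1 Rabs_R1 => /(_ ltac:(lra)).
have := near (vadd x (-1) em) em em1; rewrite vdist_vadd em1 Rabs_left1; last lra.
move=> /(_ ltac:(lra)).
have -> : vadd (vadd x 1 ep) 1 ep = zp.
  by apply: functional_extensionality => i; rewrite /vadd /ep /vsub; field.
have -> : vadd (vadd x 1 ep) (-1) ep = x.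
  by apply: functional_extensionality => i; rewrite /vadd /ep /vsub; field.
have -> : vadd (vadd x (-1) em) 1 em = x.
  by apply: functional_extensionality => i; rewrite /vadd /em /vsub; field.
have -> : vadd (vadd x (-1) em) (-1) em = zm.
  by apply: functional_extensionality => i; rewrite /vadd /em /vsub; field.
move=> low up.
have dotG : dot (vsub x c) G = 2 * dot (vsub x c) ep - 2 * dot (vsub x c) em.
  by rewrite /ep /em /G !dot_scalr dot_vaddr !(dot_vsubr _ x) !(dot_vsubr x); field.
clearbody ep em.
(* As [2 (ep - em) = G], the first-order terms leave only the defect [G] of [x] from being the
   midpoint. *)
have psi2 : (sqdist c (vadd x 1 ep) - sqdist c x) + (sqdist c (vadd x (-1) em) - sqdist c x) =
    dot (vsub x c) G + 2 * (eps * eps).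
  rewrite (sqdistE c x (vadd x 1 ep)) (sqdistE c x (vadd x (-1) em)).
  have -> : vsub (vadd x 1 ep) x = ep.
    by apply: functional_extensionality => i; rewrite /vadd /vsub; ring.
  have -> : vsub (vadd x (-1) em) x = (fun i => -1 * em i).
    by apply: functional_extensionality => i; rewrite /vadd /vsub; ring.
  rewrite !dot_scalr dot_scall -!vnorm_sqr ep1 em1.
  rewrite dotG; ring.
have G0 := vnorm_ge0 G.
have dotG_le : dot (vsub x c) G <= rho * vnorm G.
  apply: Rle_trans (Rle_abs _) _; apply: Rle_trans (cauchy_schwarz _ _) _.
  exact: Rmult_le_compat_r.
have GG : vnorm G * vnorm G <= Gam * (eps * eps * eps).
  apply: (Rmult_le_reg_l (L0 / 2)); first lra.
  have -> : L0 / 2 * (Gam * (eps * eps * eps)) = 32 * C3 * (eps * eps * eps).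
    by rewrite /Gam; field; lra.
  apply: Rle_trans gsq; apply: Rmult_le_compat_r => //; exact: Rle_0_sqr.
(* AM-GM: [|G| <= tau eps + |G|^2 / (4 tau eps)] *)
have Gle : vnorm G <= tau * eps + Gam / (4 * tau) * (eps * eps).
  have te : 0 < tau * eps by nra.
  apply: (Rmult_le_reg_l (4 * (tau * eps))); first lra.
  have -> : 4 * (tau * eps) * (tau * eps + Gam / (4 * tau) * (eps * eps)) =
    4 * (tau * eps) * (tau * eps) + Gam * (eps * eps * eps) by field; lra.
  by have := Rle_0_sqr (vnorm G - 2 * (tau * eps)); rewrite /Rsqr; lra.
have KG : K * (rho * vnorm G) <= K * rho * tau * eps + K * rho * (Gam / (4 * tau)) * (eps * eps).
  have : K * rho * vnorm G <= K * rho * (tau * eps + Gam / (4 * tau) * (eps * eps)).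
    by apply: Rmult_le_compat_l; lra.
  lra.
have Kdot : K * dot (vsub x c) G <= K * (rho * vnorm G) by apply: Rmult_le_compat_l; lra.
have total : (b - a - 4 * k) * (eps * eps) <= eps * (K * (dot (vsub x c) G + 2 * (eps * eps))).
  by rewrite -psi2; lra.
have total' : (b - a - 4 * k) * eps <= K * (dot (vsub x c) G + 2 * (eps * eps)).
  by apply: (Rmult_le_reg_l eps) => //; lra.
(* After division by [eps], the right side is below [(b - a) / 8 + (b - a) / 4], a contradiction. *)
have fin : (b - a) / 2 * eps <= eps * ((b - a) / 8 + eps * Z).
  by rewrite tauE in KG; rewrite /Z; rewrite /k in total'; lra.
have : (b - a) / 2 <= (b - a) / 8 + eps * Z by apply: (Rmult_le_reg_l eps) => //; lra.
lra.
Qed.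

Lemma visc_sub_cone_cmp (Om : vec n -> Prop) (h u : vec n -> R) x0 R0 a : is_open Om ->
  is_bounded Om -> visc_sub Om h u -> (forall y, vdist y x0 < R0 -> Om y /\ h y <= a) ->
  cone_cmp x0 R0 u a.
Proof.
move=> oOm bOm vu ball q r S r0 dom S0 Sa; apply: cone_comparison vu r0 _ S0 Sa => // y yq.
by apply: ball; have := vdist_triangle q y x0; lra.
Qed.

Lemma visc_solutions_le (Om : vec n -> Prop) (f g u : vec n -> R) x0 : is_open Om ->
  is_bounded Om -> cont_on Om f -> cont_on Om g -> visc_sol Om f u -> visc_sol Om g u ->
  Om x0 -> g x0 <= f x0.
Proof.
move=> oOm bOm cf cg [fsup fsub] [gsup gsub] Ox0; apply: Rnot_lt_le => lt.
(* A third of the gap keeps [a = f x0 + dl] strictly below [b = g x0 - dl]. *)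
pose dl := (g x0 - f x0) / 3; have dl0 : 0 < dl by rewrite /dl; lra.
have [r [r0 hr]] := oOm x0 Ox0.
have [d1 [d10 h1]] := cf x0 Ox0 _ dl0; have [d2 [d20 h2]] := cg x0 Ox0 _ dl0.
have [cu _] := fsub; have [d3 [d30 h3]] := cu x0 Ox0 1 Rlt_0_1.
pose R0 := Rmin r (Rmin d1 (Rmin d2 d3)).
have R00 : 0 < R0 by do 3?apply: Rmin_pos.
have ball y : vdist y x0 < R0 -> [/\ Om y, f y <= f x0 + dl, g x0 - dl <= g y &
    Rabs (u y - u x0) < 1].
  rewrite /vdist => /Rmin_Rgt [yr] /Rmin_Rgt [y1] /Rmin_Rgt [y2 y3].
  have Oy := hr y yr; split=> //; last by exact: h3.
  - by have := h1 y Oy y1; have := Rle_abs (f y - f x0); lra.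
  - by have := h2 y Oy y2; have := Rle_abs (- (g y - g x0)); rewrite Rabs_Ropp; lra.
have ca : cone_cmp x0 R0 u (f x0 + dl).
  by apply: visc_sub_cone_cmp fsub _ => // y /ball [].
have cb : cone_cmp x0 R0 (fun y => - u y) (- (g x0 - dl)).
  by apply: visc_sub_cone_cmp (visc_super_opp _ _ _ gsup) _ => // y /ball [Oy _ gy _]; split=> //; lra.
have le := strict_gap_locally_constant x0 R0 u (f x0 + dl) (g x0 - dl) R00 ltac:(rewrite /dl; lra)
  ca cb ltac:(by move=> y /ball []).
have x08 : vdist x0 x0 < R0 / 8 by rewrite vdist_refl; lra.
have cst y : Om y -> vdist y x0 < R0 / 8 -> u y = u x0.
  by move=> _ yx; apply: Rle_antisym; apply: le.
have cst' y : Om y -> vdist y x0 < R0 / 8 -> - u y = - u x0 by move=> Oy yx; rewrite (cst y).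
have R8 : 0 < R0 / 8 by lra.
(* Constancy of [u] and of [- u] near [x0] gives [0 <= f x0] and [0 <= - g x0], contradicting
   [f x0 < g x0]. *)
have := visc_sub_locally_constant _ _ _ x0 _ oOm bOm fsub Ox0 R8 cst.
have := visc_sub_locally_constant _ _ _ x0 _ oOm bOm (visc_super_opp _ _ _ gsup) Ox0 R8 cst'.
lra.
Qed.

End LocallyConstant.

Theorem theorem1p2 (n : nat) (Om : vec n -> Prop) (f g u : vec n -> R) :
  is_open Om -> is_bounded Om ->
  cont_on Om f -> cont_on Om g -> cont_on Om u ->
  visc_sol Om g u -> visc_sol Om f u ->
  forall x, Om x -> f x = g x.
Proof.
move=> oOm bOm cf cg _ gu fu x Ox; apply: Rle_antisym.
  exact: (visc_solutions_le Om g f u).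
exact: (visc_solutions_le Om f g u).
Qed.
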